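(* For all $f \in \mathbb{R}\langle\!\langle T\rangle\!\rangle$, the function $x \mapsto f \circ x$, defined for $x \in \mathbb{U}^{>\mathbb{R}}$ with values in $\mathbb{U}$, is strictly increasing if $f' > 0$, strictly decreasing if $f' < 0$, and constant if $f' = 0$.
   Context: Fields of transseries. Let $\mathfrak{M}$ be a multiplicatively written ordered abelian group, whose elements are called monomials. $\mathbb{R}(\!(\mathfrak{M})\!)_{\mathbf{On}}$ denotes the ordered field of all formal series $f=\sum_{i<\alpha} r_i\mathfrak{m}_i$ with $\alpha$ an ordinal, $r_i \in \mathbb{R}\setminus\{0\}$, $\mathfrak{m}_i\in\mathfrak{M}$ and $\mathfrak{m}_i>\mathfrak{m}_j$ whenever $i<j$, with the usual Hahn series operations and order ($f\neq 0$ is positive iff $r_0>0$). The support of $f$ is $\{\mathfrak{m}_i : i<\alpha\}$ and, for $f \ne 0$, $r_0\mathfrak{m}_0$ is the leading term and $\mathfrak{m}_0$ the leading monomial. A family of series is summable if the union of the supports is a set in which every non-empty subset has a maximum, and each monomial lies in only finitely many of the supports; its (infinite) sum is then computed monomial by monomial. Such a field is a field of transseries if $\mathfrak{M}$ is equipped with an isomorphism of ordered groups $\log:(\mathfrak{M},\cdot)\to (\mathbb{J}_{\mathfrak{M}},+)$, where $\mathbb{J}_{\mathfrak{M}}=\mathbb{R}(\!(\mathfrak{M}^{>1})\!)_{\mathbf{On}}$ is the group of series with support in $\mathfrak{M}^{>1}$, such that $\log(\mathfrak{m})^n<\mathfrak{m}$ for all $\mathfrak{m}\in \mathfrak{M}^{>1}$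 and $n\in\mathbb{N}$. (Then $\mathfrak{M}$ is a proper class; to avoid this one may require, for instance, that the ordinals $\alpha$ are always countable.) The inverse of $\log$ is $\exp$, and $e^\gamma=\exp(\gamma)$. One extends $\log$ to all positive series: for $f=r\mathfrak{m}(1+\varepsilon)$ with $r\mathfrak{m}$ the leading term of $f$, $r>0$, $\varepsilon$ infinitesimal, $\log(f)=\log(\mathfrak{m})+\log(r)+\sum_{n\ge1}(-1)^{n+1}\varepsilon^n/n$; $\exp$ extends to all series as the inverse of this map. $\log^{\circ n}$ is the $n$-fold composition of $\log$. A monomial $\mathfrak{m}>1$ is log-atomic if $\log^{\circ n}(\mathfrak{m})\in\mathfrak{M}$ for all $n\in\mathbb{N}$. Omega-series. Let $T$ be a log-atomic element of some field of transseries. $\mathbb{R}\langle\!\langle T\rangle\!\rangle$ (omega-series in $T$) is the smallest subclass of that field containing $\mathbb{R}$ and $T$ and closed under $\exp$, $\log$ (of positive elements) and sums $\sum_{i<\alpha}r_i\mathfrak{m}_i$ of terms whose monomials $\mathfrak{m}_i$ lie in it. It has the form $\mathbb{R}(\!(\mathfrak{O})\!)_{\mathbf{On}}$ for a subgroup $\mathfrak{O}\le\mathfrak{M}$; write $\mathbb{J}=\mathbb{R}(\!(\mathfrak{O}^{>1})\!)_{\mathbf{On}}$ for its subgroup of purely infinite series. It carries a unique derivation $f\mapsto f'$ with $T'=1$, $(e^\gamma)'=e^\gamma\gamma'$ for $\gamma\in\mathbb{J}$, and which is strongly $\mathbb{R}$-linear, i.e. $(\sum_{i<\alpha} r_i\mathfrak{m}_i)'=\sum_{i<\alpha}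 r_i\mathfrak{m}_i'$. The field $\mathbb{U}$ and composition. $\mathbb{U}$ is a fixed field of transseries that is confluent: for every $x\in\mathbb{U}$ with $x>\mathbb{R}$ there is $n\in\mathbb{N}$ such that the leading term of $\log^{\circ n}(x)$ is log-atomic. Write $\mathbb{U}^{>\mathbb{R}}=\{x\in\mathbb{U}: x>r \text{ for all } r\in\mathbb{R}\}$. For every $x\in\mathbb{U}^{>\mathbb{R}}$ there is a unique map $\mathbb{R}\langle\!\langle T\rangle\!\rangle\to\mathbb{U}$, $f\mapsto f\circ x$, with $T\circ x=x$, $e^\gamma\circ x=e^{\gamma\circ x}$ for $\gamma\in\mathbb{J}$, and $(\sum_{i<\alpha} r_i\mathfrak{m}_i)\circ x=\sum_{i<\alpha} r_i(\mathfrak{m}_i\circ x)$; it is an embedding of ordered fields preserving infinite sums, $\exp$ and $\log$. (More generally, $\mathbb{U}$ may be any field of transseries equipped with such a composition $(f,x)\mapsto f\circ x$ preserving infinite sums, multiplication by real scalars, $\exp$ and $\log$.) *)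

(* Defs.v *)
From HB Require Import structures.
From mathcomp Require Import all_boot all_order all_algebra.
From mathcomp Require Import finmap.
From mathcomp Require Import boolp classical_sets functions cardinality fsbigop.
From mathcomp Require Import reals exp.

Set Implicit Arguments.
Unset Strict Implicit.
Unset Printing Implicit Defensive.

Import Order.TTheory GRing.Theory Num.Theory.

Local Open Scope classical_set_scope.
Local Open Scope card_scope.
Local Open Scope ring_scope.

HB.mixin Record isOrderedAbGroup d G of Group G & Order.Total d G := {
  omulgC : forall x y : G, (x * y)%g = (y * x)%g;
  ole_mul2l : forall x y z : G, (x <= y)%O -> ((z * x)%g <= (z * y)%g)%O }.

#[short(type="ogroupType")]
HB.structure Definition OGroup d :=
  { G of isOrderedAbGroup d G & Group G & Order.Total d G }.

Section OrderedGroup.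
Context {d : Order.disp_t} {M : ogroupType d}.
Implicit Types a b m n : M.

Lemma olt_mul2l a b m : (a < b)%O -> ((m * a)%g < (m * b)%g)%O.
Proof.
rewrite !lt_neqAle => /andP[ab /ole_mul2l ->]; rewrite andbT.
by apply: contra ab => /eqP/mulgI ->.
Qed.

Lemma ole_mul a b m n :
  (a <= b)%O -> (m <= n)%O -> ((a * m)%g <= (b * n)%g)%O.
Proof.
move=> ab mn; apply: (@le_trans _ _ (a * n)%g); first exact: ole_mul2l.
by rewrite ![(_ * n)%g]omulgC ole_mul2l.
Qed.

Lemma olt_mul a b m n :
  (a <= b)%O -> (m < n)%O -> ((a * m)%g < (b * n)%g)%O.
Proof.
move=> ab mn; apply: (@lt_le_trans _ _ (a * n)%g); first exact: olt_mul2l.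
exact: ole_mul.
Qed.

Definition rev_wo (A : set M) : Prop :=
  forall B, B `<=` A -> B !=set0 -> exists2 m, B m & forall n, B n -> (n <= m)%O.

Definition set_mulg (A B : set M) : set M :=
  [set m | exists a b, [/\ A a, B b & m = (a * b)%g]].

Lemma rev_wo_sub A B : A `<=` B -> rev_wo B -> rev_wo A.
Proof. by move=> AB wB C CA; apply: wB => x /CA /AB. Qed.

Lemma rev_wo1 m : rev_wo [set m].
Proof. by move=> B sB [n Bn]; exists n => // k /sB ->; rewrite (sB _ Bn). Qed.

Lemma rev_woU A B : rev_wo A -> rev_wo B -> rev_wo (A `|` B).
Proof.
move=> wA wB C sC [c Cc].
have [[a [Ca Aa]]|nA] := pselect ((C `&` A) !=set0); last first.
  apply: wB; last by exists c.
  by move=> x Cx; case: (sC x Cx) => // Ax; case: nA; exists x.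
have [[b [Cb Bb]]|nB] := pselect ((C `&` B) !=set0); last first.
  apply: wA; last by exists c.
  by move=> x Cx; case: (sC x Cx) => // Bx; case: nB; exists x.
have [x [Cx Ax] mx] : exists2 m, (C `&` A) m & forall n, (C `&` A) n -> (n <= m)%O.
  by apply: wA; [move=> ? [] | exists a].
have [y [Cy By] my] : exists2 m, (C `&` B) m & forall n, (C `&` B) n -> (n <= m)%O.
  by apply: wB; [move=> ? [] | exists b].
exists (Order.max x y); first by case: leP.
move=> n Cn; rewrite le_max; case: (sC n Cn) => h.
- by rewrite mx.
- by rewrite my ?orbT.
Qed.

Lemma rev_woM A B : rev_wo A -> rev_wo B -> rev_wo (set_mulg A B).
Proof.
move=> wA wB C sC C0; apply: contrapT => noMax.
have up c : C c -> exists2 c', C c' & (c < c')%O.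
  move=> Cc; apply: contrapT => h; apply: noMax; exists c => // n Cn.
  by rewrite leNgt; apply/negP => cn; apply: h; exists n.
(* a record is a pair (a, b) with a * b in C beating every a' * b' with a' > a *)
pose rec a b := [/\ A a, B b, C (a * b)%g &
  forall a' b', (a < a')%O -> A a' -> B b' -> C (a' * b')%g ->
  ((a' * b')%g < (a * b)%g)%O].
have next c : C c -> exists a b, rec a b /\ (c < (a * b)%g)%O /\
    forall a' b', A a' -> B b' -> C (a' * b')%g ->
      (c < (a' * b')%g)%O -> (a' <= a)%O.
  move=> Cc; pose A1 := [set a | A a /\
    exists b, [/\ B b, C (a * b)%g & (c < (a * b)%g)%O]].
  have [|a [Aa [b [Bb Cab cab]]] amax] := wA A1 (fun x => @proj1 _ _).
    have [c' Cc' cc'] := up c Cc; have [a [b [Aa Bb E]]] := sC c' Cc'.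
    by exists a; split=> //; exists b; rewrite -E.
  exists a, b; split; [split=> // a' b' aa' Aa' Bb' C'|split=> //].
    rewrite ltNge; apply/negP => le.
    have := amax a'; rewrite leNgt aa' => H; suff: false by [].
    apply: H; split=> //; exists b'; split=> //; exact: lt_le_trans cab le.
  by move=> a' b' Aa' Bb' C' cc'; apply: amax; split=> //; exists b'.
have [c Cc] := C0; have [a0 [b0 [r0 _]]] := next c Cc.
have [|b [Bb [a ra]] bmax] := wB [set b | B b /\ exists a, rec a b] (fun x => @proj1 _ _).
  by exists b0; split; [case: r0|exists a0].
have [Aa _ Cab h] := ra; have [a1 [b1 [r1 [lt1 _]]]] := next _ Cab.
have [A1 B1 C1 _] := r1.
have a1a : (a1 <= a)%O.
  rewrite leNgt; apply/negP => aa1; have := h _ _ aa1 A1 B1 C1.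
  by rewrite ltNge (ltW lt1).
have b1b : (b1 <= b)%O by apply: bmax; split=> //; exists a1.
by have := ole_mul a1a b1b; rewrite leNgt lt1.
Qed.

Lemma rev_wo_finite A : rev_wo A ->
  (forall B, B `<=` A -> B !=set0 -> exists2 m, B m & forall n, B n -> (m <= n)%O) ->
  finite_set A.
Proof.
move=> wA dA; have [->|/set0P A0] := eqVneq A set0; first exact: finite_set0.
pose I p := [set a | A a /\ (a <= p)%O].
have [|p [Ap fp] pmax] := wA [set p | A p /\ finite_set (I p)] (fun x => @proj1 _ _).
  have [m Am mmin] := dA A (fun x => id) A0.
  exists m; split=> //; apply: (@sub_finite_set _ _ [set m]).
    by move=> a [Aa am] /=; apply/eqP; rewrite eq_le am mmin.
  exact: finite_set1.
have [[q0 [Aq0 pq0]]|nq] := pselect ([set q | A q /\ (p < q)%O] !=set0); last first.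
  apply: sub_finite_set fp => a Aa; split=> //; rewrite leNgt.
  by apply/negP => pa; apply: nq; exists a.
have [|q [Aq pq] qmin] := dA [set q | A q /\ (p < q)%O] (fun x => @proj1 _ _).
  by exists q0.
have := pmax q; rewrite leNgt pq => H; suff: false by []; apply: H; split=> //.
apply: (@sub_finite_set _ _ (I p `|` [set q])).
  move=> a [Aa aq]; have [ap|pa] := leP a p; first by left.
  by right; apply/eqP; rewrite eq_le aq qmin.
by rewrite finite_setU; split=> //; exact: finite_set1.
Qed.

Lemma rev_wo_div_finite A B m : rev_wo A -> rev_wo B ->
  finite_set [set a | A a /\ B (a^-1 * m)%g].
Proof.
move=> wA wB; apply: rev_wo_finite.
  by apply: rev_wo_sub wA => a [].
move=> C sC [c Cc].
have sB : [set (a^-1 * m)%g | a in C] `<=` B by move=> _ [a /sC[_ Bb] <-].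
have [|b [a Ca <-] bmax] := wB _ sB; first by exists (c^-1 * m)%g, c.
exists a => // a' Ca'; rewrite leNgt; apply/negP => a'a.
have := bmax (a'^-1 * m)%g; rewrite leNgt => H.
suff: (a^-1 * m < a'^-1 * m :> M)%O%g.
  by move=> lt; have := H (ex_intro2 _ _ a' Ca' erefl); rewrite lt.
rewrite ![(_ * m)%g]omulgC; apply: olt_mul2l.
have := olt_mul2l (a^-1 * a'^-1)%g a'a.
by rewrite -mulgA mulVg mulg1 [X in (_ < X * _)%g%O]omulgC -mulgA mulVg mulg1.
Qed.

End OrderedGroup.

Section Small.
Variable K : Type.

Definition small T (A : set T) : Prop := ~ ([set: K] #<= A).

Lemma small_sub T (A B : set T) : A `<=` B -> small B -> small A.
Proof.
by move=> AB sB KA; apply: sB; apply: card_le_trans KA (subset_card_le AB).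
Qed.

Lemma small_image T U (f : T -> U) (A : set T) : small A -> small (f @` A).
Proof.
by move=> sA KA; apply: sA; apply: card_le_trans KA (card_image_le _ _).
Qed.

End Small.

(* An uncountable regular cardinal: a set is small when it has fewer elements
   than rcard. It bounds the length of series, so that the group of monomials of
   a field of transseries can be a type. With rcard of cardinality aleph_1 the
   series are those of countable length; with rcard the ordinals of a universe,
   small means "is a set" and the series are those of length in On. *)
Record regCardinal := RegCardinal {
  rcard :> Type;
  rcard_uncountable : ~ countable [set: rcard];
  rcard_regular : forall (I T : Type) (A : set I) (F : I -> set T),
    small rcard A -> (forall i, A i -> small rcard (F i)) ->
    small rcard (\bigcup_(i in A) F i) }.

Section RegCardinal.
Variable K : regCardinal.

Lemma small_countable T (A : set T) : countable A -> small K A.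
Proof. by move=> cA KA; apply: (@rcard_uncountable K); apply: sub_countable cA. Qed.

Lemma smallU T (A B : set T) : small K A -> small K B -> small K (A `|` B).
Proof.
move=> sA sB; rewrite -bigcup2E; apply: rcard_regular.
  exact: small_countable.
by case=> [|[|i]] _ //=; apply: small_countable; exact: countable0.
Qed.

Lemma small_mulg d (M : ogroupType d) (A B : set M) :
  small K A -> small K B -> small K (set_mulg A B).
Proof.
move=> sA sB.
apply: (@small_sub _ _ _ (\bigcup_(a in A) [set (a * b)%g | b in B])).
  by move=> _ [a [b [Aa Bb ->]]]; exists a => //; exists b.
by apply: rcard_regular => // a _; exact: small_image.
Qed.

End RegCardinal.

Definition supp (T : Type) (R : nmodType) (f : T -> R) : set T :=
  [set m | f m != 0].

Section Hahn.
Variables (K : regCardinal) (R : realType) (d : Order.disp_t) (M : ogroupType d).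

(* The series with support enumerated decreasingly by an ordinal, as the family
   of its coefficients: the length exists because the support is reverse
   well-ordered. *)
Definition is_hahn : {pred M -> R} :=
  fun f => `[< rev_wo (supp f) /\ small K (supp f) >].

Record hahn := Hahn { hahn_fun :> M -> R; hahnP : is_hahn hahn_fun }.

HB.instance Definition _ := [isSub for hahn_fun].
HB.instance Definition _ := [Choice of hahn by <:].

Lemma hahn_eqP (f g : hahn) : (forall m, f m = g m) <-> f = g.
Proof. by split=> [fg|->//]; apply: val_inj; apply/funext. Qed.

Lemma supp_wo (f : hahn) : rev_wo (supp f).
Proof. by have /asboolP[] := hahnP f. Qed.

Lemma supp_small (f : hahn) : small K (supp f).
Proof. by have /asboolP[] := hahnP f. Qed.

Lemma is_hahn_sub (f : M -> R) A :
  supp f `<=` A -> rev_wo A -> small K A -> is_hahn f.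
Proof.
by move=> fA wA sA; apply/asboolP; split; [apply: rev_wo_sub wA|apply: small_sub sA].
Qed.

Lemma is_hahn_zmod : zmod_closed is_hahn.
Proof.
split.
  apply: (@is_hahn_sub _ set0); last by apply: small_countable; exact: countable0.
    by move=> m; rewrite /supp/= eqxx.
  by move=> B B0 [m /B0].
move=> f g /asboolP[wf sf] /asboolP[wg sg].
apply: (@is_hahn_sub _ (supp f `|` supp g)); [|exact: rev_woU|exact: smallU].
move=> m /= h; apply: contrapT => /not_orP[/negP/negPn/eqP f0 /negP/negPn/eqP g0].
by move: h; rewrite /supp/= !fctE f0 g0 subr0 eqxx.
Qed.
HB.instance Definition _ := GRing.isZmodClosed.Build (M -> R) is_hahn
  is_hahn_zmod.
HB.instance Definition _ := [SubChoice_isSubZmodule of hahn by <:].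

Fact is_hahn_scale (a : R) (f : hahn) : is_hahn (fun m => a * f m).
Proof.
apply: (is_hahn_sub _ (@supp_wo f) (@supp_small f)) => m.
by rewrite /supp/=; apply: contra => /eqP->; rewrite mulr0.
Qed.
Definition hahn_scale a f := Hahn (is_hahn_scale a f).

Fact hahn_scaleA a b f : hahn_scale a (hahn_scale b f) = hahn_scale (a * b) f.
Proof. by apply/hahn_eqP => m /=; rewrite mulrA. Qed.
Fact hahn_scale1 : left_id 1 hahn_scale.
Proof. by move=> f; apply/hahn_eqP => m /=; rewrite mul1r. Qed.
Fact hahn_scaleDr : right_distributive hahn_scale +%R.
Proof. by move=> a f g; apply/hahn_eqP => m; rewrite /= -mulrDr. Qed.
Fact hahn_scaleDl f : {morph hahn_scale^~ f : a b / a + b}.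
Proof. by move=> a b; apply/hahn_eqP => m; rewrite /= mulrDl. Qed.
HB.instance Definition _ := GRing.Zmodule_isLmodule.Build R hahn
  hahn_scaleA hahn_scale1 hahn_scaleDr hahn_scaleDl.


Lemma hahn0E m : (0 : hahn) m = 0. Proof. by []. Qed.
Lemma hahnDE (f g : hahn) m : (f + g) m = f m + g m. Proof. by []. Qed.
Lemma hahnNE (f : hahn) m : (- f) m = - f m. Proof. by []. Qed.
Lemma hahnZE a (f : hahn) m : (a *: f) m = a * f m. Proof. by []. Qed.


Definition hahn_mul_fun (f g : M -> R) : M -> R :=
  fun m => \sum_(a \in [set: M]) f a * g (a^-1 * m)%g.

Lemma hahn_mul_neq0 (f g : M -> R) m : hahn_mul_fun f g m != 0 ->
  exists a, f a != 0 /\ g (a^-1 * m)%g != 0.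
Proof.
move=> h; apply: contrapT => nfg; move/eqP: h; apply.
apply: fsbig1 => a _; have [->|f0] := eqVneq (f a) 0; first by rewrite mul0r.
have [->|g0] := eqVneq (g (a^-1 * m)%g) 0; first by rewrite mulr0.
by case: nfg; exists a.
Qed.

Fact is_hahn_mul (f g : hahn) : is_hahn (hahn_mul_fun f g).
Proof.
apply: (@is_hahn_sub _ (set_mulg (supp f) (supp g))).
- move=> m /hahn_mul_neq0[a [f0 g0]]; exists a, (a^-1 * m)%g.
  by rewrite mulgA mulgV mul1g.
- exact: rev_woM (@supp_wo f) (@supp_wo g).
- exact: small_mulg (@supp_small f) (@supp_small g).
Qed.
Definition hahn_mul f g := Hahn (is_hahn_mul f g).

Fact is_hahn_mon (n : M) : is_hahn (fun m => (m == n)%:R).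
Proof.
apply: (@is_hahn_sub _ [set n]); last exact/small_countable/countable1.
- by move=> m; rewrite /supp/=; have [->//|_] := eqVneq m n; rewrite eqxx.
- exact: rev_wo1.
Qed.
Definition mon n := Hahn (is_hahn_mon n).

Lemma hahn_mulE (f g : hahn) m (X : {fset M}) :
  (forall a, f a != 0 -> g (a^-1 * m)%g != 0 -> a \in X) ->
  hahn_mul f g m = \sum_(a <- X) f a * g (a^-1 * m)%g.
Proof.
move=> h; rewrite /= /hahn_mul_fun; apply: fsbigTE => a aX.
have [->|f0] := eqVneq (f a) 0; first by rewrite mul0r.
have [->|g0] := eqVneq (g (a^-1 * m)%g) 0; first by rewrite mulr0.
by rewrite h in aX.
Qed.

Lemma hahn_mul_fin (f g : hahn) m :
  finite_set [set a | f a != 0 /\ g (a^-1 * m)%g != 0].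
Proof. exact: rev_wo_div_finite (@supp_wo f) (@supp_wo g). Qed.

Lemma hahn_mulC : commutative hahn_mul.
Proof.
move=> f g; apply/hahn_eqP => m.
rewrite /= /hahn_mul_fun (@reindex_fsbigT _ _ _ _ _ (fun a : M => (a^-1 * m)%g)).
  apply: eq_fsbigr => a _.
  by rewrite mulrC; congr (g _ * f _); rewrite ?invgM ?invgK omulgC mulgA mulgV mul1g.
exists (fun a : M => (m * a^-1)%g) => a.
  by rewrite invgM invgK mulgA mulgV mul1g.
by rewrite invgM invgK -mulgA mulVg mulg1.
Qed.

Lemma hahn_mul1 : left_id (mon 1%g) hahn_mul.
Proof.
move=> f; apply/hahn_eqP => m.
rewrite (@hahn_mulE _ _ _ [fset 1%g]%fset); last first.
  move=> a /=; have [-> _ _|_] := eqVneq a 1%g; first by rewrite inE.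
  by rewrite eqxx.
by rewrite big_seq_fset1 /= eqxx mul1r invg1 mul1g.
Qed.

Lemma hahn_mulDl : left_distributive hahn_mul +%R.
Proof.
move=> f g h; apply/hahn_eqP => m.
pose X := fset_set ([set a | f a != 0 /\ h (a^-1 * m)%g != 0] `|`
                    [set a | g a != 0 /\ h (a^-1 * m)%g != 0]).
have finX : finite_set ([set a | f a != 0 /\ h (a^-1 * m)%g != 0] `|`
                    [set a | g a != 0 /\ h (a^-1 * m)%g != 0]).
  by rewrite finite_setU; split; exact: hahn_mul_fin.
rewrite hahnDE !(@hahn_mulE _ _ _ X).
- by rewrite -big_split /=; apply: eq_bigr => a _; rewrite -mulrDl.
- by move=> a g0 h0; rewrite /X in_fset_set// inE; right.
- by move=> a f0 h0; rewrite /X in_fset_set// inE; left.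
- move=> a fg0 h0; rewrite /X in_fset_set// inE /=.
  have [f0|] := eqVneq (f a) 0; last by left.
  by right; split=> //; move: fg0; rewrite hahnDE f0 add0r.
Qed.

Lemma hahn_mulA : associative hahn_mul.
Proof.
move=> f g h; apply/hahn_eqP => m.
pose A := [set a | supp f a /\ set_mulg (supp g) (supp h) (a^-1 * m)%g].
pose B a := [set b | supp g b /\ supp h (b^-1 * (a^-1 * m))%g].
pose P := \bigcup_(a in A) [set (a, (a * b)%g) | b in B a].
have finP : finite_set P.
  apply: bigcup_finite => [|a _].
    by apply: rev_wo_div_finite; [exact: supp_wo|apply: rev_woM; exact: supp_wo].
  by apply: finite_image; apply: rev_wo_div_finite; exact: supp_wo.
pose X := fset_set (fst @` P); pose Y := fset_set (snd @` P).
have inP a c : f a != 0 -> g (a^-1 * c)%g != 0 -> h (c^-1 * m)%g != 0 -> P (a, c).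
  move=> f0 g0 h0; have E : ((a^-1 * c)^-1 * (a^-1 * m))%g = (c^-1 * m)%g.
    by rewrite invgM invgK mulgA -(mulgA c^-1%g) mulgV mulg1.
  exists a.
    split=> //; exists (a^-1 * c)%g, (c^-1 * m)%g; split=> //.
    by rewrite mulgA -(mulgA a^-1%g) mulgV mulg1.
  exists (a^-1 * c)%g; first by split=> //; rewrite /supp/= E.
  by rewrite mulgA mulgV mul1g.
have inX a c : P (a, c) -> a \in X.
  move=> Pac; rewrite in_fset_set; last exact: finite_image.
  by rewrite inE; exists (a, c).
have inY a c : P (a, c) -> c \in Y.
  move=> Pac; rewrite in_fset_set; last exact: finite_image.
  by rewrite inE; exists (a, c).
transitivity (\sum_(a <- X) \sum_(c <- Y) f a * g (a^-1 * c)%g * h (c^-1 * m)%g).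
  rewrite (@hahn_mulE _ _ _ X).
    apply: eq_bigr => a _; have [->|f0] := eqVneq (f a) 0.
      by rewrite mul0r big1// => c _; rewrite !mul0r.
    under eq_bigr do rewrite -mulrA; rewrite -big_distrr /=; congr (_ * _).
    rewrite /hahn_mul_fun (@reindex_fsbigT _ _ _ _ _ (fun c : M => (a^-1 * c)%g)).
      rewrite (@fsbigTE _ _ _ _ Y).
        apply: eq_bigr => c _; congr (_ * h _).
        by rewrite invgM invgK mulgA -(mulgA c^-1%g) mulgV mulg1.
      move=> c cY; have [->|g0] := eqVneq (g (a^-1 * c)%g) 0; first by rewrite mul0r.
      rewrite invgM invgK mulgA -(mulgA c^-1%g) mulgV mulg1.
      have [->|h0] := eqVneq (h (c^-1 * m)%g) 0; first by rewrite mulr0.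
      by move: cY; rewrite (inY a c)//; exact: inP.
    exists (fun c : M => (a * c)%g) => c.
      by rewrite mulgA mulgV mul1g.
    by rewrite mulgA mulVg mul1g.
  move=> a f0 /hahn_mul_neq0[b [g0 h0]]; apply: (inX a (a * b)%g); apply: inP => //.
    by rewrite mulgA mulVg mul1g.
  by rewrite invgM -mulgA.
rewrite exchange_big (@hahn_mulE _ _ _ Y) /=.
  apply: eq_bigr => c _; have [->|h0] := eqVneq (h (c^-1 * m)%g) 0.
    by rewrite mulr0 big1// => a _; rewrite mulr0.
  rewrite -big_distrl /=; congr (_ * _).
  rewrite -[hahn_mul_fun _ _ _]/(hahn_mul f g c) (@hahn_mulE _ _ _ X)//.
  by move=> a f0 g0; apply: (inX a c); exact: inP.
by move=> c /hahn_mul_neq0[a [f0 g0]] h0; apply: (inY a c); exact: inP.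
Qed.

Fact mon1_neq0 : mon 1%g != 0.
Proof.
apply/eqP => /hahn_eqP /(_ 1%g) /eqP; rewrite /= eqxx.
by rewrite (negbTE (oner_neq0 _)).
Qed.

HB.instance Definition _ := GRing.Zmodule_isComNzRing.Build hahn
  hahn_mulA hahn_mulC hahn_mul1 hahn_mulDl mon1_neq0.

Fact hahn_scalerAl (a : R) (f g : hahn) : a *: (f * g) = a *: f * g.
Proof.
apply/hahn_eqP => m; rewrite hahnZE.
pose X := fset_set [set b | f b != 0 /\ g (b^-1 * m)%g != 0].
have finX := hahn_mul_fin f g m.
rewrite -[(f * g) m]/(hahn_mul f g m).
rewrite -[(_ * g) m]/(hahn_mul (a *: f) g m) !(@hahn_mulE _ _ _ X).
- by rewrite big_distrr; apply: eq_bigr => b _; rewrite /= mulrA.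
- move=> b fb gb; rewrite in_fset_set// inE; split=> //.
  by apply: contra fb => /eqP; rewrite hahnZE => ->; rewrite mulr0.
- by move=> b fb gb; rewrite in_fset_set// inE.
Qed.
HB.instance Definition _ := GRing.Lmodule_isLalgebra.Build R hahn hahn_scalerAl.
HB.instance Definition _ := GRing.Lalgebra_isComAlgebra.Build R hahn.


Implicit Types f g : hahn.
Definition is_lead (f : hahn) m : Prop :=
  f m != 0 /\ forall n, (m < n)%O -> f n = 0.

Lemma lead_ex f : f != 0 -> exists m, is_lead f m.
Proof.
move=> f0; have [|m fm mmax] := supp_wo (fun m => id) (_ : supp f !=set0).
  apply: contrapT => s0; move/eqP: f0; apply; apply/hahn_eqP => m.
  by apply/eqP; apply: contrapT => /negP fm; apply: s0; exists m.
exists m; split=> // n mn; apply/eqP; apply: contrapT => /negP /mmax.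
by rewrite leNgt mn.
Qed.

Lemma lead_mulP f g a b : is_lead f a -> is_lead g b ->
  (f * g) (a * b)%g = f a * g b /\
  forall n, ((a * b)%g < n)%O -> (f * g) n = 0.
Proof.
move=> [fa af] [gb bg].
have ab n c : ((a * b)%g <= n)%O -> f c != 0 -> g (c^-1 * n)%g != 0 ->
    c = a /\ n = (a * b)%g.
  move=> abn fc gc.
  have ca : (c <= a)%O by rewrite leNgt; apply: contra fc => /af ->.
  have cb : ((c^-1 * n)%g <= b)%O by rewrite leNgt; apply: contra gc => /bg ->.
  have nE : n = (c * (c^-1 * n))%g by rewrite mulgA mulgV mul1g.
  move: ca; rewrite le_eqVlt => /orP[/eqP ca|ca].
    split=> //; apply: le_anti; rewrite abn andbT nE; apply: ole_mul => //.
    by rewrite ca.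
  suff: (n < a * b :> M)%O%g by rewrite ltNge abn.
  by rewrite nE omulgC [(a * b)%g]omulgC; exact: olt_mul.
split.
  rewrite -[LHS]/(hahn_mul f g _) (@hahn_mulE _ _ _ [fset a]%fset).
    by rewrite big_seq_fset1 mulgA mulVg mul1g.
  by move=> c fc gc; rewrite inE; have [->] := ab _ _ (lexx _) fc gc.
move=> n abn; apply/eqP; apply: contrapT => /negP/hahn_mul_neq0[c [fc gc]].
by have [_ E] := ab _ _ (ltW abn) fc gc; rewrite E ltxx in abn.
Qed.

Lemma lead_mul f g a b : is_lead f a -> is_lead g b -> is_lead (f * g) (a * b)%g.
Proof.
move=> la lb; have [E H] := lead_mulP la lb; split=> //.
by rewrite E mulf_neq0//; [case: la|case: lb].
Qed.

Lemma lead_uniq f a b : is_lead f a -> is_lead f b -> a = b.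
Proof.
move=> [fa af] [fb bf]; case: (ltgtP a b) => // ab.
- by rewrite af// eqxx in fb.
- by rewrite bf// eqxx in fa.
Qed.

Lemma lead_neq0 f a : is_lead f a -> f != 0.
Proof. by move=> [fa _]; apply: contra fa => /eqP ->. Qed.

Lemma hahn_mulf_eq0 (f g : hahn) : f * g = 0 -> (f == 0) || (g == 0).
Proof.
move=> fg; have [//|/lead_ex[a la]] := eqVneq f 0.
have [//|/lead_ex[b lb]] := eqVneq g 0.
by have := lead_neq0 (lead_mul la lb); rewrite fg eqxx.
Qed.

(* The inverse is that of the ring; that every nonzero series has one (Neumann)
   is not recorded here. *)
Definition hahn_unit : {pred hahn} := fun f : hahn => `[< exists g : hahn, g * f = 1 >].
Definition hahn_inv (f : hahn) : hahn := xget f [set g | g * f = 1].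

Fact hahn_mulV : {in hahn_unit, left_inverse (1 : hahn) hahn_inv (@GRing.mul hahn)}.
Proof. by move=> f /asboolP fu; rewrite /hahn_inv; apply: (xgetPex f fu). Qed.
Fact hahn_unitP (f g : hahn) : g * f = 1 -> hahn_unit f.
Proof. by move=> gf; apply/asboolP; exists g. Qed.
Fact hahn_inv_out : {in [predC hahn_unit], hahn_inv =1 id}.
Proof.
move=> f nu; apply: xgetPN => g gf.
by move: nu; rewrite inE /= => /negP; apply; apply/asboolP; exists g.
Qed.

HB.instance Definition _ := GRing.ComNzRing_hasMulInverse.Build hahn
  hahn_mulV hahn_unitP hahn_inv_out.
HB.instance Definition _ := GRing.ComUnitRing_isIntegral.Build hahn hahn_mulf_eq0.

Definition hahn_pos (f : hahn) : Prop := exists2 m, is_lead f m & 0 < f m.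

Definition hahn_lt (f g : hahn) := `[< hahn_pos (g - f) >].
Definition hahn_le (f g : hahn) := (f == g) || hahn_lt f g.
Definition hahn_norm (f : hahn) := if hahn_lt f 0 then - f else f.

Lemma lead_opp f m : is_lead f m -> is_lead (- f) m.
Proof. by move=> [fm mf]; split=> [|n /mf]; rewrite hahnNE ?oppr_eq0// => ->; rewrite oppr0. Qed.

Lemma hahn_lt0E f : hahn_lt 0 f = `[< hahn_pos f >].
Proof. by rewrite /hahn_lt subr0. Qed.

Lemma hahn_ltf0E f : hahn_lt f 0 = `[< hahn_pos (- f) >].
Proof. by rewrite /hahn_lt sub0r. Qed.

Fact hahn_lt0_add f g : hahn_lt 0 f -> hahn_lt 0 g -> hahn_lt 0 (f + g).
Proof.
rewrite !hahn_lt0E => /asboolP[a [fa af] pa] /asboolP[b [gb bg] pb].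
apply/asboolP; case: (ltgtP a b) => ab.
- exists b; last by rewrite hahnDE (af _ ab) add0r.
  split=> [|n bn]; rewrite hahnDE; first by rewrite (af _ ab) add0r.
  by rewrite bg// af ?addr0//; exact: lt_trans bn.
- exists a; last by rewrite hahnDE (bg _ ab) addr0.
  split=> [|n an]; rewrite hahnDE; first by rewrite (bg _ ab) addr0.
  by rewrite af// bg ?addr0//; exact: lt_trans an.
- rewrite -ab in bg pb; have p : 0 < (f + g) a by rewrite hahnDE addr_gt0.
  exists a => //; split=> [|n an]; first by rewrite gt_eqF.
  by rewrite hahnDE af// bg// addr0.
Qed.

Fact hahn_lt0_mul f g : hahn_lt 0 f -> hahn_lt 0 g -> hahn_lt 0 (f * g).
Proof.
rewrite !hahn_lt0E => /asboolP[a la pa] /asboolP[b lb pb].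
apply/asboolP; exists (a * b)%g; first exact: lead_mul.
by rewrite (lead_mulP la lb).1 mulr_gt0.
Qed.

Fact hahn_lt0_ngt0 f : hahn_lt 0 f -> ~~ hahn_lt f 0.
Proof.
rewrite hahn_lt0E hahn_ltf0E => /asboolP[a la pa].
apply/negP => /asboolP[b lb]; rewrite -(lead_uniq (lead_opp la) lb).
by rewrite hahnNE oppr_gt0 ltNge ltW.
Qed.

Fact hahn_sub_gt0 f g : hahn_lt 0 (g - f) = hahn_lt f g.
Proof. by rewrite hahn_lt0E. Qed.

Fact hahn_lt0_total f : f != 0 -> hahn_lt 0 f || hahn_lt f 0.
Proof.
move=> /lead_ex[m lm]; rewrite hahn_lt0E hahn_ltf0E.
have [fm _] := lm; case: (ltgtP 0 (f m)) => [p|p|E].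
- by apply/orP; left; apply/asboolP; exists m.
- apply/orP; right; apply/asboolP; exists m; first exact: lead_opp.
  by rewrite hahnNE oppr_gt0.
- by rewrite -E eqxx in fm.
Qed.

Fact hahn_normN f : hahn_norm (- f) = hahn_norm f.
Proof.
have [->|f0] := eqVneq f 0; first by rewrite oppr0.
have E : hahn_lt (- f) 0 = hahn_lt 0 f by rewrite hahn_ltf0E hahn_lt0E opprK.
rewrite /hahn_norm E; have /orP[p|p] := hahn_lt0_total f0.
  by rewrite p opprK (negbTE (hahn_lt0_ngt0 p)).
by rewrite p; case: ifP => // /hahn_lt0_ngt0; rewrite p.
Qed.

Fact hahn_ge0_norm f : hahn_le 0 f -> hahn_norm f = f.
Proof.
rewrite /hahn_le /hahn_norm => /orP[/eqP <-|/hahn_lt0_ngt0/negbTE ->//].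
by case: ifP => //; rewrite oppr0.
Qed.

Fact hahn_le_def f g : hahn_le f g = (f == g) || hahn_lt f g.
Proof. by []. Qed.

HB.instance Definition _ := Num.IntegralDomain_isLtReal.Build hahn
  hahn_lt0_add hahn_lt0_mul hahn_lt0_ngt0 hahn_sub_gt0 hahn_lt0_total
  hahn_normN hahn_ge0_norm hahn_le_def.

Lemma hahn_gt0P f : reflect (hahn_pos f) (0 < f).
Proof. by rewrite -[0 < f]/(hahn_lt 0 f) hahn_lt0E; exact: asboolP. Qed.

End Hahn.

Arguments mon {K R d M} n.

Section Sums.
Variables (K : regCardinal) (R : realType) (d : Order.disp_t) (M : ogroupType d).
Local Notation H := (hahn K R M).

Definition summable (I : Type) (F : I -> H) : Prop :=
  [/\ rev_wo (\bigcup_i supp (F i)), small K (\bigcup_i supp (F i)) &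
      forall m, finite_set [set i | supp (F i) m]].

Definition is_sum (I : choiceType) (F : I -> H) (s : H) : Prop :=
  summable F /\ forall m, s m = \sum_(i \in [set: I]) F i m.

Definition hsum (I : choiceType) (F : I -> H) : H := xget 0 (is_sum F).

(* The additive group J_M. *)
Definition purely_infinite : set H :=
  [set f | supp f `<=` [set m | (1%g < m)%O]].

(* The leading monomial; the default value 1 is that of f = 0. *)
Definition lead_mon (f : H) : M := xget 1%g (is_lead f).

Definition gt_reals (x : H) : Prop := forall r : R, (r%:A : H) < x.

End Sums.

Record transseries (K : regCardinal) (R : realType) := Transseries {
  tdisp : Order.disp_t;
  tmon : ogroupType tdisp;
  tlog : tmon -> hahn K R tmon;
  tlogM : forall m n, tlog (m * n)%g = tlog m + tlog n;
  tlog_lt : forall m n, (m < n)%O -> tlog m < tlog n;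
  tlog_pinf : forall m, purely_infinite (tlog m);
  tlog_onto : forall g, purely_infinite g -> exists m, tlog m = g;
  tlog_growth : forall m, (1%g < m)%O -> forall n, tlog m ^+ n < mon m }.

Definition tfield K R (A : transseries K R) := hahn K R (tmon A).
Coercion tfield : transseries >-> Sortclass.

Section LogExp.
Variables (K : regCardinal) (R : realType) (A : transseries K R).

(* The series is indexed from 0: its n-th term is the one of degree n + 1.
   The value is only meaningful at f > 0. *)
Definition hlog (f : A) : A :=
  let m := lead_mon f in
  let eps : A := (f m)^-1 *: (f * mon m^-1%g) - 1 in
  tlog m + (ln (f m))%:A
  + hsum (fun n : nat => ((-1) ^+ n / n.+1%:R) *: eps ^+ n.+1).

Definition hexp (g : A) : A := xget 0 [set f | 0 < f /\ hlog f = g].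

Definition log_atomic (T : tmon A) : Prop :=
  (1%g < T)%O /\ forall n, exists m, iter n hlog (mon T) = mon m.

(* R<<T>>. In omega_sum, f is the sum of its terms f m *: mon m for m in its
   support. *)
Inductive omega (T : tmon A) : A -> Prop :=
| omega_real (r : R) : omega T r%:A
| omega_var : omega T (mon T)
| omega_exp (f : A) : omega T f -> omega T (hexp f)
| omega_log (f : A) : omega T f -> 0 < f -> omega T (hlog f)
| omega_sum (f : A) : (forall m, supp f m -> omega T (mon m)) -> omega T f.

Definition omega_mon (T : tmon A) : set (tmon A) := [set m | omega T (mon m)].

(* omega_mon T is the group O with R<<T>> = R((O)), and omega_pinf T is
   J = R((O^{>1})). *)
Definition omega_pinf (T : tmon A) : set A :=
  [set g : A | supp g `<=` omega_mon T `&` [set m | (1%g < m)%O]].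

(* D is the derivation of R<<T>>; its values outside R<<T>> are irrelevant. In
   der_sum the terms with m outside the support of f vanish, so that they do not
   affect summability, and the others have mon m in R<<T>>. *)
Record is_derivation (T : tmon A) (D : A -> A) : Prop := IsDerivation {
  der_omega : forall f, omega T f -> omega T (D f);
  derD : forall f g, omega T f -> omega T g -> D (f + g) = D f + D g;
  derM : forall f g, omega T f -> omega T g -> D (f * g) = D f * g + f * D g;
  der_var : D (mon T) = 1;
  der_exp : forall g, omega_pinf T g -> D (hexp g) = hexp g * D g;
  der_sum : forall f, omega T f ->
    is_sum (fun m => f m *: D (mon m)) (D f) }.

End LogExp.

(* comp f x is "f o x"; it is only constrained for f in R<<T>> and x > R. No
   confluence of U is assumed: when U is confluent these three conditions
   determine f o x uniquely, and in general they express that composition with x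
   preserves infinite sums, real scalars and exp. *)
Record is_composition K R (A U : transseries K R) (T : tmon A)
    (comp : A -> U -> U) : Prop := IsComposition {
  comp_var : forall x, gt_reals x -> comp (mon T) x = x;
  comp_exp : forall g x, omega_pinf T g -> gt_reals x ->
    comp (hexp g) x = hexp (comp g x);
  comp_sum : forall f x, omega T f -> gt_reals x ->
    is_sum (fun m => f m *: comp (mon m) x) (comp f x) }.

(* Main.v *)
(* Increments are compared monomial by monomial. Let Delta be either the derivation
   or the difference f |-> f o y - f o x for x < y, and let v m be the leading
   monomial of Delta m. Then Delta(e^g) = e^g g' in the first case, and
   Delta(e^g) = e^(g o x) (exp(Delta g) - 1) in the second, which has size
   e^(g o x) Delta g as long as Delta g is infinitesimal. In both cases v is
   strictly increasing on the monomials m <> 1, and Delta m > 0 iff m > 1: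
   - for 1 < m < n by induction on log m and log n;
   - for m < 1 < n by bounding v m from above and v n from below along the
     sequences of iterated leading monomials of logarithms started at m and n,
     which end up in the sequence log^k T and hence meet;
   - for m < n < 1 by comparison of m / n < 1 with the leading monomial of log n.
   By strong linearity the sign of Delta f is therefore determined by the leading
   term of f distinct from its constant term, in the same way for f' and for
   f o y - f o x. *)

Require Import Defs.
From mathcomp Require Import all_boot all_order all_algebra.
From mathcomp Require Import finmap.
From mathcomp Require Import boolp classical_sets functions cardinality fsbigop.
From mathcomp Require Import reals sequences exp.

Set Implicit Arguments.
Unset Strict Implicit.
Unset Printing Implicit Defensive.

Import Order.TTheory GRing.Theory Num.Theory.

Local Open Scope classical_set_scope.
Local Open Scope ring_scope.

(** * Neumann's lemma *)

Section Neumann.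
Context {d : Order.disp_t} {M : ogroupType d}.
Implicit Types (a b m n : M) (W : set M).

Lemma olt_mul2r a b m : (a < b)%O -> ((a * m)%g < (b * m)%g)%O.
Proof. by move=> ab; rewrite ![(_ * m)%g]omulgC olt_mul2l. Qed.

Lemma omul_lt1l a b : (a < 1%g)%O -> ((a * b)%g < b)%O.
Proof. by move=> a1; rewrite -[X in (_ < X)%O]mul1g olt_mul2r. Qed.

Lemma omul_gt1l a b : (1%g < a)%O -> (b < (a * b)%g)%O.
Proof. by move=> a1; rewrite -[X in (X < _)%O]mul1g olt_mul2r. Qed.

Fixpoint set_pow W k : set M :=
  if k is k'.+1 then set_mulg W (set_pow W k') else [set 1%g].

Lemma set_powD W k l a b :
  set_pow W k a -> set_pow W l b -> set_pow W (k + l) (a * b)%g.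
Proof.
elim: k a => [|k IH] a /=; first by move=> ->; rewrite mul1g.
move=> [w [v [Ww kv ->]]] lb; exists w, (v * b)%g; rewrite mulgA.
by split=> //; exact: IH.
Qed.

Lemma set_pow_small (K : regCardinal) W k : small K W -> small K (set_pow W k).
Proof.
move=> sW; elim: k => [|k IH] /=; first exact/small_countable/countable1.
exact: small_mulg.
Qed.

(* Nash-Williams' minimal bad sequence, with sets in place of sequences: among
   the inaccessible elements B, those of minimal length above a given one form a
   set without maximum contained in the product of W by the complement of B. *)
Lemma set_pow_wo W : rev_wo W -> (forall w, W w -> (w < 1%g)%O) ->
  rev_wo (\bigcup_k set_pow W k).
Proof.
move=> wW W1; pose P := \bigcup_k set_pow W k; rewrite -/P.
pose good w := rev_wo [set v | P v /\ (w <= v)%O].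
have [noB|] := pselect (forall w, P w -> good w).
  move=> C CP [w Cw].
  have [| |v [Cv wv] vmax] := noB w (CP _ Cw) [set v | C v /\ (w <= v)%O].
  - by move=> v [/CP Pv wv].
  - by exists w; split=> //; exact: lexx.
  exists v => // n Cn; have [wn|nw] := leP w n; first exact: vmax.
  by apply: le_trans wv; exact: ltW.
move=> /existsNP[w0 /not_implyP[Pw0 bw0]]; exfalso.
pose B w := P w /\ ~ good w.
have upB b : B b -> exists2 b', B b' & (b < b')%O.
  move=> [Pb nb]; apply: contrapT => h; apply: nb => C sC [c0 Cc0].
  have [[c [Cc bc]]|nc] := pselect (exists c, C c /\ (b < c)%O); last first.
    exists c0 => // n Cn; have [_ ] := sC _ Cc0.
    have [_ ] := sC _ Cn; rewrite !le_eqVlt => /orP[/eqP <-|bn].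
      by move=> ->.
    by case: nc; exists n.
  have gc : good c.
    by apply: contrapT => ngc; apply: h; exists c => //; split=> //; case: (sC _ Cc).
  have [| |v [Cv cv] vmax] := gc [set v | C v /\ (c <= v)%O].
  - by move=> v [/sC[Pv _] cv].
  - by exists c; split=> //; exact: lexx.
  exists v => // n Cn; have [cn|nc] := leP c n; first exact: vmax.
  by apply: le_trans cv; exact: ltW.
pose V := [set v | P v /\ good v].
have wV : rev_wo V.
  move=> C CV [w Cw].
  have [| |v [Cv wv] vmax] := (CV _ Cw).2 [set v | C v /\ (w <= v)%O].
  - by move=> v [/CV[Pv _] wv].
  - by exists w; split=> //; exact: lexx.
  exists v => // n Cn; have [wn|nw] := leP w n; first exact: vmax.
  by apply: le_trans wv; exact: ltW.
pose B' b := B b /\ exists c k, [/\ (c < b)%O, set_pow W k b &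
  forall b' l, B b' -> (c < b')%O -> set_pow W l b' -> (k <= l)%N].
have upB' c : B c -> exists2 b, B' b & (c < b)%O.
  move=> Bc; have [b Bb cb] := upB c Bc.
  have ex : exists k, `[< exists b, [/\ B b, (c < b)%O & set_pow W k b] >].
    by have [[k _ kb] _] := Bb; exists k; apply/asboolP; exists b.
  case: (ex_minnP ex) => k /asboolP[b' [Bb' cb' kb']] kmin.
  exists b' => //; split=> //; exists c, k; split=> // b'' l Bb'' cb'' lb''.
  by apply: kmin; apply/asboolP; exists b''.
have B'sub : B' `<=` set_mulg W V.
  move=> b [Bb [c [[|k] [cb kb kmin]]]].
    (* Length 0 would force [b = 1], the maximum of [P], whereas [B] has no maximum. *)
    have [b' Bb' bb'] := upB _ Bb; have [[l _ lb'] _] := Bb'.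
    suff: (b' <= 1%g)%O by rewrite -kb leNgt bb'.
    elim: l b' lb' {Bb' bb'} => [|l IH] b' /= => [->//|[w [v [Ww lv ->]]]].
    by apply: le_trans (IH _ lv); apply/ltW/omul_lt1l/W1.
  have [w [v [Ww kv E]]] := kb; exists w, v; split=> //.
  have Pv : P v by exists k.
  split=> //; apply: contrapT => nv.
  (* If [v] were in [B], it would lie above [c], since [b = w * v < v], and be shorter than [b],
     against minimality. *)
  have := kmin v k (conj Pv nv) _ kv; rewrite ltnn; apply/not_implyP; split=> //.
  by apply: lt_trans cb _; rewrite E; exact/omul_lt1l/W1.
have [b B'b _] := upB' w0 (conj Pw0 bw0).
have [|m B'm mmax] := rev_woM wW wV B'sub; first by exists b.
have [b' /mmax] := upB' m B'm.1.
by rewrite leNgt => /negP.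
Qed.

(** Let [m0] be the largest element that is a product of infinitely many different lengths. Only
    finitely many [w] can be its first factor, and each cofactor [w^-1 * m0] exceeds [m0], so it has
    finitely many lengths, and so does [m0]. *)
Lemma set_pow_finite W m : rev_wo W -> (forall w, W w -> (w < 1%g)%O) ->
  finite_set [set k | set_pow W k m].
Proof.
move=> wW W1; apply: contrapT => infm.
have wP := set_pow_wo wW W1; set P := \bigcup_k set_pow W k in wP.
have [|m0 [Pm0 inf0] max0] := wP
    [set m | P m /\ ~ finite_set [set k | set_pow W k m]] (fun _ => @proj1 _ _).
  exists m; split=> //; apply: contrapT => nP; apply: infm.
  suff -> : [set k | set_pow W k m] = set0 by exact: finite_set0.
  by apply/seteqP; split=> // k kk; apply: nP; exists k.
have up v : (m0 < v)%O -> finite_set [set k | set_pow W k v].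
  move=> mv; have [Pv|nP] := pselect (P v).
    apply: contrapT => nf; have := max0 v (conj Pv nf).
    by rewrite leNgt mv.
  suff -> : [set k | set_pow W k v] = set0 by exact: finite_set0.
  by apply/seteqP; split=> // k kk; apply: nP; exists k.
apply: inf0.
pose X := [set a | W a /\ P (a^-1 * m0)%g].
have fX : finite_set X by exact: rev_wo_div_finite.
apply: (@sub_finite_set _ _ ([set 0%N] `|`
   \bigcup_(a in X) (succn @` [set k | set_pow W k (a^-1 * m0)%g]))).
  case=> [|k] /=; first by left.
  move=> [w [v [Ww kv E]]]; right.
  have vE : (w^-1 * m0)%g = v by rewrite E mulgA mulVg mul1g.
  by exists w; [split=> //; rewrite vE; exists k|exists k => //=; rewrite vE].
rewrite finite_setU; split; first exact: finite_set1.
apply: bigcup_finite => // a [Wa _]; apply: finite_image; apply: up.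
rewrite -[X in (X < _)%O](mulKg a) -[X in (X < _)%O]/(a^-1 * (a * m0))%g.
by apply: olt_mul2l; exact/omul_lt1l/W1.
Qed.

End Neumann.

(** * Hahn series and the logarithmic series *)

Section HahnLemmas.
Variables (K : regCardinal) (R : realType) (d : Order.disp_t) (M : ogroupType d).
Local Notation H := (hahn K R M).
Implicit Types (f g : H) (m n p : M).

Lemma lead_monP f : f != 0 -> is_lead f (lead_mon f).
Proof. by move=> /lead_ex fP; rewrite /lead_mon; apply: (xgetPex 1%g fP). Qed.

Lemma lead_monE f m : is_lead f m -> lead_mon f = m.
Proof. by move=> fm; exact: lead_uniq (lead_monP (lead_neq0 fm)) fm. Qed.

Lemma lead_gt0 f m : is_lead f m -> (0 < f) = (0 < f m).
Proof.
move=> fm; apply/hahn_gt0P/idP => [[n fn] f0|f0].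
  by rewrite (lead_uniq fm fn).
by exists m.
Qed.

Lemma lead_lt0 f m : is_lead f m -> (f < 0) = (f m < 0).
Proof. by move=> fm; rewrite -oppr_gt0 (lead_gt0 (lead_opp fm)) hahnNE oppr_gt0. Qed.

Lemma gt0_lead_coef f : 0 < f -> 0 < f (lead_mon f).
Proof. by move=> f0; rewrite -(lead_gt0 (lead_monP (lt0r_neq0 f0))). Qed.

Lemma lead_ge f m n : is_lead f m -> f n != 0 -> (n <= m)%O.
Proof. by move=> [_ h]; rewrite leNgt; apply: contra => /h ->. Qed.

(** [below f 1] says that [f] is infinitesimal. It covers [f = 0], whose [lead_mon] is the default
    value 1. *)
Definition below f p := forall n, (p <= n)%O -> f n = 0.

Lemma below_lead f p : f != 0 -> (lead_mon f < p)%O -> below f p.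
Proof. by move=> /lead_monP[_ h] lp n pn; apply: h; exact: lt_le_trans pn. Qed.

Lemma below0 p : below (0 : H) p. Proof. by []. Qed.

Lemma below_lt f p n : below f p -> f n != 0 -> (n < p)%O.
Proof. by move=> bf; rewrite ltNge; apply: contra => /bf ->. Qed.

Lemma below_trans f p q : (p <= q)%O -> below f p -> below f q.
Proof. by move=> pq bf n qn; apply: bf; exact: le_trans qn. Qed.

Lemma below_mul f g p :
  (forall n, (p < n)%O -> f n = 0) -> below g 1%g -> below (f * g) p.
Proof.
move=> fp g1 n pn; apply/eqP; apply: contrapT => /negP/hahn_mul_neq0[a [fa ga]].
have ap : (a <= p)%O by rewrite leNgt; apply: contra fa => /fp ->.
have := olt_mul ap (below_lt g1 ga).
by rewrite mulgA mulgV mul1g mulg1 ltNge pn.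
Qed.

Lemma below_exp f k : below f 1%g -> below (f ^+ k.+1) 1%g.
Proof.
move=> f1; elim: k => [//|k IH]; rewrite exprS; apply: below_mul => // n n1.
exact/f1/ltW.
Qed.

Lemma below_add f g p : below f p -> below g p -> below (f + g) p.
Proof. by move=> bf bg n pn; rewrite hahnDE bf// bg// addr0. Qed.

Lemma mul_monE f m n : (f * mon n) m = f (n^-1 * m)%g.
Proof.
rewrite mulrC -[LHS]/(hahn_mul (mon n) f m) (@hahn_mulE _ _ _ _ _ _ _ [fset n]%fset).
  by rewrite big_seq_fset1 /= eqxx mul1r.
by move=> a /=; have [-> _ _|_] := eqVneq a n; rewrite ?inE ?eqxx.
Qed.

Lemma lead_mon_mon m : is_lead (mon m : H) m.
Proof.
split=> /= [|n mn]; first by rewrite eqxx oner_neq0.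
by rewrite gt_eqF.
Qed.

Lemma mon_gt0 m : 0 < mon m :> H.
Proof. by rewrite (lead_gt0 (lead_mon_mon m)) /= eqxx ltr01. Qed.

Lemma hahn_realE (r : R) m : (r%:A : H) m = r * (m == 1%g)%:R.
Proof. by []. Qed.

Lemma is_sum_ex (I : choiceType) (F : I -> H) : summable F -> exists s, is_sum F s.
Proof.
move=> sF; have [wF kF finF] := sF.
have hs : is_hahn K (fun m => \sum_(i \in [set: I]) F i m).
  apply: (is_hahn_sub _ wF kF) => m; rewrite /supp/= => /eqP h; apply: contrapT => nm.
  apply: h; apply: fsbig1 => i _; apply/eqP; apply: contrapT => /negP Fi.
  by apply: nm; exists i.
by exists (Hahn hs).
Qed.

Lemma is_sum_uniq (I : choiceType) (F : I -> H) s t :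
  is_sum F s -> is_sum F t -> s = t.
Proof. by move=> [_ sE] [_ tE]; apply/hahn_eqP => m; rewrite sE tE. Qed.

Lemma hsumP (I : choiceType) (F : I -> H) : summable F -> is_sum F (hsum F).
Proof. by move=> /is_sum_ex sF; rewrite /hsum; apply: (xgetPex 0 sF). Qed.

Lemma is_sum_eq0 (I : choiceType) (F : I -> H) s m :
  is_sum F s -> (forall i, F i m = 0) -> s m = 0.
Proof. by move=> [_ ->] F0; apply: fsbig1 => i _. Qed.

Lemma is_sum_eq1 (I : choiceType) (F : I -> H) s m i0 :
  is_sum F s -> (forall i, i != i0 -> F i m = 0) -> s m = F i0 m.
Proof.
move=> [_ ->] F0; rewrite (fsbigTE [fset i0]%fset) ?big_seq_fset1//.
by move=> i; rewrite inE => ii0; exact: F0.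
Qed.

Lemma is_sumB (I : choiceType) (F G : I -> H) s t : is_sum F s -> is_sum G t ->
  is_sum (fun i => F i - G i) (s - t).
Proof.
move=> [[wF kF fF] sE] [[wG kG fG] tE].
have sub i m : (F i - G i) m != 0 -> F i m != 0 \/ G i m != 0.
  rewrite hahnDE hahnNE; have [->|] := eqVneq (F i m) 0; last by left.
  by rewrite add0r oppr_eq0; right.
have fin m : finite_set [set i | supp (F i) m \/ supp (G i) m].
  have -> : [set i | supp (F i) m \/ supp (G i) m] =
      [set i | supp (F i) m] `|` [set i | supp (G i) m] by [].
  by rewrite finite_setU; split; [exact: fF|exact: fG].
split; first split.
- apply: rev_wo_sub (rev_woU wF wG) => m [i _ /sub[h|h]]; [left|right]; by exists i.
- apply: small_sub (smallU kF kG) => m [i _ /sub[h|h]]; [left|right]; by exists i.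
- by move=> m; apply: sub_finite_set (fin m) => i /sub.
move=> m; rewrite hahnDE hahnNE sE tE.
have inX i : F i m != 0 \/ G i m != 0 ->
    i \in fset_set [set i | supp (F i) m \/ supp (G i) m].
  by move=> h; rewrite in_fset_set// inE.
rewrite !(fsbigTE (fset_set [set i | supp (F i) m \/ supp (G i) m])).
- by rewrite -sumrB; apply: eq_bigr => i _; rewrite hahnDE hahnNE.
- by move=> i; apply: contraNeq => h; apply/inX/sub.
- by move=> i; apply: contraNeq => h; apply/inX; right.
- by move=> i; apply: contraNeq => h; apply/inX; left.
Qed.

Definition log_term f (k : nat) : H := ((-1) ^+ k / k.+1%:R) *: f ^+ k.+1.
Definition log1p f : H := hsum (log_term f).

Lemma supp_exp f k : supp (f ^+ k) `<=` set_pow (supp f) k.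
Proof.
elim: k => [|k IH] m; rewrite /supp/=.
  by have [//|_] := eqVneq m 1%g; rewrite eqxx.
rewrite exprS => /hahn_mul_neq0[a [fa ga]]; exists a, (a^-1 * m)%g; split=> //.
- exact: IH.
- by rewrite mulgA mulgV mul1g.
Qed.

Lemma supp_log_term f k : supp (log_term f k) `<=` set_pow (supp f) k.+1.
Proof.
move=> m h; apply: supp_exp; move: h; rewrite /log_term /supp /= mulf_eq0.
by case/norP.
Qed.

Lemma log1pP f : below f 1%g -> is_sum (log_term f) (log1p f).
Proof.
move=> f1; apply: hsumP; have s1 w : supp f w -> (w < 1%g)%O by exact: below_lt.
have wf := @supp_wo _ _ _ _ f; split.
- apply: rev_wo_sub (set_pow_wo wf s1) => m [k _ /supp_log_term h].
  by exists k.+1.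
- apply: (@small_sub _ _ _ (\bigcup_k set_pow (supp f) k)).
    by move=> m [k _ /supp_log_term h]; exists k.+1.
  apply: rcard_regular; first exact: small_countable.
  by move=> k _; apply/set_pow_small/supp_small.
- move=> m; apply: (@sub_finite_set _ _ (predn @` [set k | set_pow (supp f) k m])).
    by move=> k /supp_log_term h; exists k.+1.
  exact/finite_image/set_pow_finite.
Qed.

(** Only the linear term contributes at [p] and above: in degree at least 2, [f - g] divides the
    difference of powers with an infinitesimal cofactor, which pushes the support below [p]. *)
Lemma log1p_agree f g p m : below f 1%g -> below g 1%g ->
  (forall n, (p < n)%O -> f n = g n) -> (p <= m)%O ->
  log1p f m - log1p g m = f m - g m.
Proof.
move=> f1 g1 fg pm.
have := @is_sum_eq1 _ _ _ m 0%N (is_sumB (log1pP f1) (log1pP g1)).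
rewrite hahnDE hahnNE => -> => [|[//|k] _].
  by rewrite hahnDE hahnNE /log_term !expr1 expr0 divr1 !scale1r.
rewrite /log_term -scalerBr hahnZE; have -> : (f ^+ k.+2 - g ^+ k.+2) m = 0.
  rewrite subrXX; apply: (@below_mul _ _ p) pm => [n /fg|].
    by rewrite hahnDE hahnNE => ->; rewrite subrr.
  (* The cofactor of [f - g] is a sum of products of total degree [k + 1], hence infinitesimal. *)
  move=> n n1; elim/big_ind: _ => [//|a b a0 b0|i _].
    by rewrite hahnDE a0 b0 addr0.
  rewrite -[k.+2.-1]/k.+1; case: (nat_of_ord i) => [|{}i].
    by rewrite subn0 expr0 mulr1; exact: below_exp.
  apply: (@below_mul _ _ 1%g) n1 => [q q1|]; last exact: below_exp.
  case: (k.+1 - i.+1)%N => [|j]; last exact/below_exp/ltW.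
  by rewrite -[LHS]/((q == 1%g)%:R) gt_eqF.
by rewrite mulr0.
Qed.

Lemma log_term0 k : log_term 0 k = 0.
Proof. by rewrite /log_term expr0n scaler0. Qed.

Lemma log1p0 : log1p 0 = 0.
Proof.
apply/hahn_eqP => m; rewrite hahn0E; apply: (is_sum_eq0 (log1pP (@below0 _))) => k.
by rewrite log_term0.
Qed.

Lemma log1p_below f : below f 1%g -> below (log1p f) 1%g.
Proof.
move=> f1 m m1; rewrite -[LHS]subr0 -[0](hahn0E K R m) -{1}log1p0.
rewrite (@log1p_agree _ _ 1%g)//; first by rewrite f1// subrr.
by move=> n /ltW/f1 ->.
Qed.

(** Every term of the series has positive degree, so its monomials are nonempty products of
    monomials of [f]. *)
Lemma supp_log1p f (G : set M) : below f 1%g -> supp f `<=` G ->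
  (forall a b, G a -> G b -> G (a * b)%g) -> supp (log1p f) `<=` G.
Proof.
move=> f1 fG GM m; rewrite /supp/=; apply: contraNP => nG; apply/eqP.
apply: is_sum_eq0 (log1pP f1) _ => k; apply/eqP; apply: contrapT => /negP.
move=> /supp_log_term; elim: k m nG => [|k IH] m nG [w [v [/fG Ww kv E]]].
  by apply: nG; rewrite E kv mulg1.
have [Gv|] := pselect (G v); last by move=> /IH; exact.
by apply: nG; rewrite E; exact: GM.
Qed.

Lemma log1p_lead f g n : below f 1%g -> below g 1%g -> is_lead (f - g) n ->
  is_lead (log1p f - log1p g) n /\ (log1p f - log1p g) n = (f - g) n.
Proof.
move=> f1 g1 [fn0 hn].
have E m : (n <= m)%O -> (log1p f - log1p g) m = (f - g) m.
  move=> nm; rewrite !hahnDE !hahnNE (@log1p_agree _ _ n)// => q /hn.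
  by rewrite hahnDE hahnNE => /eqP; rewrite subr_eq0 => /eqP.
split; last exact: E.
by split=> [|m nm]; rewrite E ?lexx ?ltW// hn.
Qed.

Lemma is_hahn_hrestrict f (P : set M) : is_hahn K (fun m => f m * (m \in P)%:R).
Proof.
apply: (is_hahn_sub _ (@supp_wo _ _ _ _ f) (@supp_small _ _ _ _ f)) => m.
by rewrite /supp/=; apply: contra => /eqP ->; rewrite mul0r.
Qed.
Definition hrestrict f (P : set M) : H := Hahn (is_hahn_hrestrict f P).

Lemma hrestrictT f (P : set M) m : P m -> hrestrict f P m = f m.
Proof. by move=> Pm; rewrite /= mem_set// mulr1. Qed.

Lemma hrestrictF f (P : set M) m : ~ P m -> hrestrict f P m = 0.
Proof. by move=> Pm; rewrite /= memNset// mulr0. Qed.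

(** Truncate [f] strictly above its largest monomial [n] outside [G]. The logarithms of [f] and of
    the truncation both vanish at [n], so by [log1p_agree] the coefficient of [f] at [n] vanishes
    too. *)
Lemma log1p_supp_inv f (G : set M) : below f 1%g -> supp (log1p f) `<=` G ->
  (forall a b, G a -> G b -> G (a * b)%g) -> supp f `<=` G.
Proof.
move=> f1 lG GM; apply: contrapT => /existsNP[m0 /not_implyP[fm0 nG0]].
have [| |n [fn nGn] nmax] := supp_wo (_ : [set m | supp f m /\ ~ G m] `<=` supp f)
   (_ : [set m | supp f m /\ ~ G m] !=set0).
- by move=> m [].
- by exists m0.
pose g := hrestrict f [set m | (n < m)%O].
have g1 : below g 1%g by move=> m m1; rewrite /= f1// mul0r.
have gG : supp g `<=` G.
  move=> m; rewrite /supp/= mulf_eq0 => /norP[fm].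
  have [nm _|/negP nm] := boolP (n < m)%O; last by rewrite memNset ?eqxx.
  by apply: contrapT => nGm; have := nmax m (conj fm nGm); rewrite leNgt nm.
have := @log1p_agree f g n n f1 g1 _ (lexx _).
have -> : log1p g n = 0.
  by apply/eqP; apply: contrapT => /negP h; apply: nGn; exact: (supp_log1p g1 gG GM h).
have -> : log1p f n = 0.
  by apply/eqP; apply: contrapT => /negP h; apply: nGn; exact: lG.
rewrite (@hrestrictF f _ n) ?subr0 /=; last by rewrite ltxx.
by move=> /(_ (fun m nm => esym (hrestrictT f nm)))/esym/eqP; rewrite (negbTE fn).
Qed.

End HahnLemmas.

(** * Surjectivity of the logarithmic series onto the infinitesimals *)

Section Log1pOnto.
Variables (K : regCardinal) (R : realType) (d : Order.disp_t) (M : ogroupType d).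
Local Notation H := (hahn K R M).
Implicit Types (f g h : H) (m n p : M).

(** At the largest monomial where [f] and [g] differ, [log1p_agree] makes their logarithms differ by
    the same amount. *)
Lemma log1p_approx_uniq f g h p : below f 1%g -> below g 1%g ->
  (forall m, (p <= m)%O -> log1p f m = h m) ->
  (forall m, (p <= m)%O -> log1p g m = h m) ->
  forall m, (p <= m)%O -> f m = g m.
Proof.
move=> f1 g1 fh gh m pm; apply/eqP; rewrite -subr_eq0; apply: contrapT => /negP fg.
have [| |n [fn pn] nmax] := supp_wo
    (_ : [set m | (f - g) m != 0 /\ (p <= m)%O] `<=` supp (f - g)).
- by move=> q [].
- by exists m; split; [exact: fg|].
move: fn; rewrite hahnDE hahnNE -(log1p_agree f1 g1 _ (lexx n)).
  by rewrite fh// gh// subrr eqxx.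
move=> q nq; apply/eqP; rewrite -subr_eq0; apply: contrapT => /negP fgq.
have := nmax q; rewrite leNgt nq => E; suff: false by []; apply: E.
by split; [exact: fgq|exact: le_trans pn (ltW nq)].
Qed.

(** The equation is solved coefficient by coefficient, by induction downwards along the reverse
    well-ordered semigroup [S] generated by the support of [h]. [approx p f] says that [f] is a
    solution down to [p]. *)
Lemma log1p_onto h : below h 1%g -> exists2 f, below f 1%g & log1p f = h.
Proof.
move=> h1; pose W := supp h; pose S := \bigcup_k set_pow W k.+1.
have W1 w : W w -> (w < 1%g)%O by exact: below_lt.
have SM a b : S a -> S b -> S (a * b)%g.
  move=> [k _ ka] [l _ lb]; exists (k + l.+1)%N => //.
  by rewrite -addSn; exact: set_powD.
have WS : W `<=` S by move=> w Ww; exists 0%N => //; exists w, 1%g; rewrite mulg1.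
have S1 m : S m -> (m < 1%g)%O.
  move=> [k _]; elim: k m => [|k IH] m [w [v [/W1 w1 kv ->]]].
    by rewrite kv mulg1.
  by apply: lt_trans (IH _ kv); exact: omul_lt1l.
have wS : rev_wo S.
  apply: rev_wo_sub (set_pow_wo (@supp_wo _ _ _ _ h) W1) => m [k _ km].
  by exists k.+1.
have sS : small K S.
  apply: rcard_regular; first exact: small_countable.
  by move=> k _; apply/set_pow_small/supp_small.
pose approx p f := [/\ below f 1%g, supp f `<=` S &
  forall m, (p <= m)%O -> log1p f m = h m].
(* Where an approximation exists, [e m] is the coefficient at [m] shared by all approximations valid
   down to [m]. *)
pose e m := (xget 0 (approx m)) m.
have eE p f m : approx p f -> (p <= m)%O -> f m = e m.
  move=> [f1 fS fh] pm; have am : approx m f.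
    by split=> // q mq; apply: fh; exact: le_trans mq.
  have [g1 _ gh] : approx m (xget 0 (approx m)).
    by apply: (xgetPex 0 (ex_intro _ f am)).
  by apply: (log1p_approx_uniq f1 g1 _ gh) => // q mq; apply: fh; exact: le_trans mq.
(* Approximations are glued along a final segment [Z] of [S]; outside [S] both [log1p f] and [h]
   vanish. *)
have glue (Z : set M) : Z `<=` S -> (forall p m, Z p -> S m -> (p <= m)%O -> Z m) ->
    (forall p, Z p -> exists f, approx p f) ->
    exists f, [/\ below f 1%g, supp f `<=` S &
      forall m, Z m \/ ~ S m -> log1p f m = h m].
  move=> ZS Zup Zap.
  have hZ : is_hahn K (fun m => e m * (m \in Z)%:R).
    apply: (is_hahn_sub _ wS sS) => m; rewrite /supp/= mulf_eq0 => /norP[_].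
    by have [/set_mem/ZS//|_] := boolP (m \in Z); rewrite eqxx.
  pose f := Hahn hZ.
  have fS : supp f `<=` S.
    move=> m; rewrite /supp/= mulf_eq0 => /norP[_].
    by have [/set_mem/ZS//|_] := boolP (m \in Z); rewrite eqxx.
  have f1 : below f 1%g.
    move=> m m1; apply/eqP; apply: contrapT => /negP/fS/S1.
    by rewrite ltNge m1.
  exists f; split=> // p [Zp|nS]; last first.
    have /negP/negPn/eqP -> : ~ log1p f p != 0.
      by move=> /(supp_log1p f1 fS SM).
    by apply/esym/eqP; apply: contrapT => /negP/WS.
  have [g ag] := Zap p Zp; have [g1 gS gh] := ag.
  have fg m : (p <= m)%O -> f m = g m.
    move=> pm; have [Sm|nS] := pselect (S m).
      by rewrite (eE _ _ _ ag pm) /= mem_set ?mulr1//; exact: Zup pm.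
    have /negP/negPn/eqP -> : ~ f m != 0 by move=> /fS.
    by apply/esym/eqP; apply: contrapT => /negP/gS.
  have := log1p_agree f1 g1 (fun n pn => fg n (ltW pn)) (lexx p).
  by rewrite fg// subrr gh// => /eqP; rewrite subr_eq0 => /eqP.
have ap p : S p -> exists f, approx p f.
  move=> Sp; apply: contrapT => np.
  have [| |n [Sn nn] nmax] := wS [set m | S m /\ ~ exists f, approx m f].
  - by move=> m [].
  - by exists p.
  apply: nn.
  have [|p' m [_ np'] Sm pm|p' [Sp' np']|f [f1 fS fh]] :=
    glue [set m | S m /\ (n < m)%O].
  - by move=> m [].
  - by split=> //; exact: lt_le_trans pm.
  - apply: contrapT => nap; have := nmax p' (conj Sp' nap).
    by rewrite leNgt np'.
  (* Adding [c] times [n] to [f] changes the logarithm by exactly [c] at [n] and not at all above,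
     so the defect at [n] is corrected. *)
  pose c := h n - log1p f n; pose g : H := f + c *: mon n.
  have gE m : m != n -> g m = f m.
    by move=> mn; rewrite hahnDE hahnZE /= (negbTE mn) mulr0 addr0.
  have gS : supp g `<=` S.
    move=> m gm0; have [-> //|/gE gm] := eqVneq m n.
    by apply: fS; rewrite /supp /= -gm.
  have g1 : below g 1%g.
    move=> m m1; apply/eqP; apply: contrapT => /negP/gS/S1.
    by rewrite ltNge m1.
  exists g; split=> // m; have [nm|//] := leP n m; move=> _.
  have ag q : (n < q)%O -> g q = f q by move=> nq; rewrite gE// gt_eqF.
  have := log1p_agree g1 f1 ag nm.
  move: nm; rewrite le_eqVlt => /orP[/eqP <-|nm].
    rewrite hahnDE hahnZE /= eqxx mulr1 [in RHS]addrC addKr /c.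
    by move=> /addIr.
  rewrite ag// subrr => /eqP; rewrite subr_eq0 => /eqP ->; apply: fh.
  by have [Sm|] := pselect (S m); [left|right].
have [//|//|//|f [f1 fS fh]] := glue S.
exists f => //; apply/hahn_eqP => m; apply: fh.
by have [Sm|] := pselect (S m); [left|right].
Qed.

End Log1pOnto.

(** * Logarithm and exponential of a field of transseries *)

Section LogExpLemmas.
Variables (K : regCardinal) (R : realType) (A : transseries K R).
Local Notation H := (hahn K R (tmon A)).
Implicit Types (f g F G : A) (m n p : tmon A).

Lemma tlog1 : tlog (1%g : tmon A) = 0.
Proof. by apply: (addIr (tlog (1%g : tmon A))); rewrite -tlogM mulg1 add0r. Qed.

Lemma tlogV m : tlog m^-1%g = - tlog m.
Proof. by apply/eqP; rewrite -addr_eq0 -tlogM mulVg tlog1. Qed.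

Lemma tlog_mono : {mono (@tlog _ _ A) : m n / (m <= n)%O >-> m <= n}.
Proof. by apply: le_mono => m n; exact: tlog_lt. Qed.

Lemma tlog_inj : injective (@tlog _ _ A).
Proof. exact: inc_inj tlog_mono. Qed.

Lemma tlog_gt0 m : (0 < tlog m) = (1%g < m)%O.
Proof. by rewrite -tlog1 (leW_mono tlog_mono). Qed.

Lemma tlog_lt0 m : (tlog m < 0) = (m < 1%g)%O.
Proof. by rewrite -tlog1 (leW_mono tlog_mono). Qed.

Lemma tlog_eq0 m : (tlog m == 0) = (m == 1%g).
Proof. by rewrite -tlog1 (inj_eq tlog_inj). Qed.

Lemma tlog_supp_gt1 m n : tlog m n != 0 -> (1%g < n)%O.
Proof. exact: tlog_pinf. Qed.

Lemma tlog_le1 m n : (n <= 1%g)%O -> tlog m n = 0.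
Proof.
by move=> n1; apply/eqP; apply: contraT => /tlog_supp_gt1; rewrite ltNge n1.
Qed.

Definition heps f : A := (f (lead_mon f))^-1 *: (f * mon (lead_mon f)^-1%g) - 1.

Lemma hepsE f n :
  heps f n = (f (lead_mon f))^-1 * f (lead_mon f * n)%g - (n == 1%g)%:R.
Proof. by rewrite /heps hahnDE hahnNE hahnZE mul_monE invgK. Qed.

Lemma heps_below f : f != 0 -> below (heps f) 1%g.
Proof.
move=> /lead_monP[fm hm] n; rewrite le_eqVlt hepsE => /orP[/eqP <-|n1].
  by rewrite mulg1 mulVf// eqxx subrr.
rewrite (hm (_ * n)%g); last by rewrite omulgC; exact: omul_gt1l.
by rewrite mulr0 gt_eqF// subr0.
Qed.

Lemma heps_coef f n : f != 0 ->
  f n = f (lead_mon f) * ((n == lead_mon f)%:R + heps f ((lead_mon f)^-1 * n)%g).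
Proof.
move=> /lead_monP[fm _]; rewrite hepsE mulgA mulgV mul1g.
have -> : ((lead_mon f)^-1 * n == 1)%g = (n == lead_mon f).
  apply/eqP/eqP => [E|->]; last by rewrite mulVg.
  by rewrite -[n]mul1g -(mulgV (lead_mon f)) -mulgA E mulg1.
by rewrite addrC subrK mulrA mulfV// mul1r.
Qed.

Lemma hlogE f : hlog f = tlog (lead_mon f) + (ln (f (lead_mon f)))%:A + log1p (heps f).
Proof. by []. Qed.

(** The three summands of [hlog f] are supported above, at and below 1, so each range of
    coefficients isolates one of them. *)
Lemma hlog_gt1 f p : f != 0 -> (1%g < p)%O -> hlog f p = tlog (lead_mon f) p.
Proof.
move=> f0 p1; rewrite hlogE !hahnDE (log1p_below (heps_below f0) (ltW p1)) addr0.
by rewrite hahn_realE gt_eqF// mulr0 addr0.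
Qed.

Lemma hlog_1 f : f != 0 -> hlog f 1%g = ln (f (lead_mon f)).
Proof.
move=> f0; rewrite hlogE !hahnDE (log1p_below (heps_below f0) (lexx _)) addr0.
by rewrite hahn_realE eqxx mulr1 tlog_le1// add0r.
Qed.

Lemma hlog_lt1 f p : (p < 1%g)%O -> hlog f p = log1p (heps f) p.
Proof.
move=> p1; rewrite hlogE !hahnDE tlog_le1 ?ltW// add0r.
by rewrite hahn_realE lt_eqF// mulr0 add0r.
Qed.

(** The purely infinite, constant and infinitesimal parts of [g] are exponentiated separately, by
    [tlog_onto], [expR] and [log1p_onto]. *)
Lemma hlog_onto g : exists2 f : A, 0 < f & hlog f = g.
Proof.
have [|m mE] := @tlog_onto _ _ A (hrestrict g [set m | (1%g < m)%O]).
  move=> m; rewrite /supp/= mulf_eq0 => /norP[_].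
  by have [/set_mem//|_] := boolP (m \in _); rewrite eqxx.
have [|e e1 eE] := @log1p_onto K R _ _ (hrestrict g [set m | (m < 1%g)%O]).
  by move=> n n1; apply: hrestrictF; apply/negP; rewrite -leNgt.
pose r := expR (g 1%g); have r0 : 0 < r := expR_gt0 _.
pose f : A := r *: (mon m * (1 + e)).
have fE n : f n = r * ((n == m)%:R + e (m^-1 * n)%g).
  rewrite /f hahnZE (mulrC (mon m)) mul_monE hahnDE; congr (r * (_ + _)).
  rewrite -[LHS]/(((m^-1 * n)%g == 1%g)%:R); congr (_%:R : R); congr nat_of_bool.
  apply/eqP/eqP => [E|->]; last by rewrite mulVg.
  by rewrite -[n]mul1g -(mulgV m) -mulgA E mulg1.
have fm : f m = r by rewrite fE eqxx mulVg e1// addr0 mulr1.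
have lf : is_lead f m.
  split=> [|n mn]; first by rewrite fm gt_eqF.
  rewrite fE gt_eqF// e1 ?addr0 ?mulr0//.
  by rewrite -(mulVg m); exact/ltW/olt_mul2l.
have epsE : heps f = e.
  apply/hahn_eqP => n; rewrite hepsE (lead_monE lf) fm fE mulKf ?(gt_eqF r0)//.
  rewrite mulgA mulVg mul1g.
  suff -> : (m * n == m)%g = (n == 1%g) by rewrite addrC addKr.
  apply/eqP/eqP => [E|->]; last by rewrite mulg1.
  by rewrite -[n]mul1g -(mulVg m) -mulgA E.
have f0 : 0 < f by rewrite (lead_gt0 lf) fm.
exists f => //; apply/hahn_eqP => n; case: (ltgtP n 1%g) => [n1|n1|->].
- by rewrite hlog_lt1// epsE eE hrestrictT.
- by rewrite hlog_gt1 ?gt_eqF// (lead_monE lf) mE hrestrictT.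
- by rewrite hlog_1 ?gt_eqF// (lead_monE lf) fm expRK.
Qed.

(** With [u = hlog G - hlog F], these clauses give the size of [G - F = F (e^u - 1)]: that of [G]
    unless [u] is infinitesimal, and that of [F u] otherwise. *)
Variant hlog_sub_spec F G : Prop :=
| HlogSub of 0 < hlog G - hlog F &
    (lead_mon (G - F) <= lead_mon G)%O &
    (1%g <= lead_mon (hlog G - hlog F) -> lead_mon (G - F) = lead_mon G)%O &
    ((lead_mon (hlog G - hlog F) < 1%g)%O -> lead_mon F = lead_mon G /\
       lead_mon (G - F) = (lead_mon F * lead_mon (hlog G - hlog F))%g) &
    ((1%g < lead_mon (hlog G - hlog F))%O -> (lead_mon F < lead_mon G)%O).

(** The leading monomials are compared first, then the leading coefficients, then the infinitesimal
    parts [heps]; accordingly [u] is infinite, has a nonzero constant as leading term, or is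
    infinitesimal. *)
Lemma hlog_subP F G : 0 < F -> F < G -> hlog_sub_spec F G.
Proof.
move=> F0 FG; have G0 := lt_trans F0 FG.
have nF := lt0r_neq0 F0; have nG := lt0r_neq0 G0.
have lF := lead_monP nF; have lG := lead_monP nG.
have Fc := gt0_lead_coef F0; have Gc := gt0_lead_coef G0.
set u := hlog G - hlog F; set a := lead_mon F; set b := lead_mon G.
have uE p : u p = hlog G p - hlog F p by rewrite /u hahnDE hahnNE.
have ulead p : is_lead u p -> 0 < u p -> 0 < u /\ lead_mon u = p.
  by move=> lu up; rewrite (lead_gt0 lu) (lead_monE lu).
have dlead p : is_lead (G - F) p -> 0 < (G - F) p /\ lead_mon (G - F) = p.
  by move=> ld; rewrite -(lead_gt0 ld) subr_gt0 FG (lead_monE ld).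
have [ab|ba|ab] := ltgtP a b.
- pose w := tlog b - tlog a; have w0 : 0 < w by rewrite subr_gt0 tlog_lt.
  have lw := lead_monP (lt0r_neq0 w0); set q := lead_mon w in lw.
  have q1 : (1%g < q)%O.
    rewrite ltNge; apply/negP => q1; case: lw => + _.
    by rewrite /w hahnDE hahnNE !tlog_le1// subrr eqxx.
  have uw p : (1%g < p)%O -> u p = w p by move=> p1; rewrite uE !hlog_gt1 ?hahnDE.
  have [u0 lu] : 0 < u /\ lead_mon u = q.
    apply: ulead; last by rewrite uw// -(lead_gt0 lw).
    split=> [|n qn]; first by rewrite uw//; case: lw.
    by rewrite uw ?(lt_trans q1)//; case: lw => _; exact.
  have [_ ld] : 0 < (G - F) b /\ lead_mon (G - F) = b.
    apply: dlead; split=> [|n bn].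
      by rewrite hahnDE hahnNE lF.2// subr0 gt_eqF.
    by rewrite hahnDE hahnNE lF.2 ?lG.2 ?subr0//; exact: lt_trans bn.
  by split; rewrite ?ld ?lu ?lexx// ltNge ltW.
- suff : G < F by rewrite ltNge ltW.
  rewrite -subr_gt0 (@lead_gt0 _ _ _ _ _ a).
    by rewrite hahnDE hahnNE lG.2// subr0.
  split=> [|n bn]; first by rewrite hahnDE hahnNE lG.2// subr0 gt_eqF.
  by rewrite hahnDE hahnNE lF.2 ?lG.2 ?subr0//; exact: lt_trans bn.
- have [rs|rs] := eqVneq (F a) (G b); last first.
    have [r0 ld] : 0 < (G - F) b /\ lead_mon (G - F) = b.
      apply: dlead; split=> [|n bn].
        by rewrite hahnDE hahnNE subr_eq0 eq_sym -[X in F X]ab.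
      by rewrite hahnDE hahnNE lF.2 -/a ?ab ?lG.2 ?subr0.
    have u1 : 0 < u 1%g.
      rewrite uE !hlog_1// subr_gt0 ltr_ln ?posrE//.
      by move: r0; rewrite hahnDE hahnNE subr_gt0 -[X in F X]ab.
    have [u0 lu] : 0 < u /\ lead_mon u = 1%g.
      apply: ulead => //; split=> [|n n1]; first by rewrite gt_eqF.
      by rewrite uE !hlog_gt1// -/a -/b ab subrr.
    by split; rewrite ?ld ?lu ?lexx ?ltxx.
  have dE n : (G - F) n = F a * (heps G - heps F) (b^-1 * n)%g.
    rewrite hahnDE hahnNE (heps_coef n nF) (heps_coef n nG) -/a -/b -rs ab -mulrBr.
    by rewrite opprD addrACA subrr add0r hahnDE hahnNE.
  have e0 : heps G - heps F != 0.
    apply/eqP => e0; have : G - F = 0.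
      by apply/hahn_eqP => n; rewrite dE e0 mulr0.
    by move/eqP; rewrite subr_eq0 gt_eqF.
  have le := lead_monP e0; set q := lead_mon _ in le.
  have q1 : (q < 1%g)%O.
    rewrite ltNge; apply/negP => q1; case: le.
    by rewrite hahnDE hahnNE !heps_below// subrr eqxx.
  have uq n : (n <= 1%g)%O -> u n = (log1p (heps G) - log1p (heps F)) n.
    rewrite uE hahnDE hahnNE le_eqVlt => /orP[/eqP ->|n1]; last by rewrite !hlog_lt1.
    by rewrite !hlog_1// -/a -/b rs subrr !(log1p_below (heps_below _))// subrr.
  have [ll lE] := log1p_lead (heps_below nG) (heps_below nF) le.
  have [d0 ld] : 0 < (G - F) (b * q)%g /\ lead_mon (G - F) = (b * q)%g.
    apply: dlead; split=> [|n bn]; rewrite dE.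
      by rewrite mulgA mulVg mul1g mulf_neq0 ?(gt_eqF Fc)//; case: le.
    rewrite le.2 ?mulr0//; have := olt_mul2l b^-1%g bn.
    by rewrite mulgA mulVg mul1g.
  have [u0 lu] : 0 < u /\ lead_mon u = q.
    apply: ulead.
      split=> [|n qn]; first by rewrite uq ?ltW//; case: ll.
      have [n1|n1] := leP n 1%g; first by rewrite uq//; case: ll => _; exact.
      by rewrite uE !hlog_gt1// -/a -/b ab subrr.
    rewrite uq ?ltW// lE; move: d0.
    by rewrite dE mulgA mulVg mul1g pmulr_rgt0.
  split; rewrite ?ld ?lu//.
  + by rewrite omulgC; apply/ltW/omul_lt1l.
  + by rewrite leNgt q1.
  + by rewrite -/a -/b ab.
  + by rewrite ltNge ltW.
Qed.

Lemma hlog_lt F G : 0 < F -> 0 < G -> (hlog F < hlog G) = (F < G).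
Proof.
move=> F0 G0; apply/idP/idP => [FG|/(hlog_subP F0)[]]; last by rewrite subr_gt0.
have [//|GF|E] := ltgtP F G; last by rewrite E ltxx in FG.
have [] := hlog_subP G0 GF; rewrite subr_gt0 => /(lt_trans FG).
by rewrite ltxx.
Qed.

Lemma hlog_inj F G : 0 < F -> 0 < G -> hlog F = hlog G -> F = G.
Proof.
move=> F0 G0 E; have [FG|FG|//] := ltgtP F G.
  by move: FG; rewrite -hlog_lt// E ltxx.
by move: FG; rewrite -hlog_lt// E ltxx.
Qed.

Lemma hexpP g : 0 < hexp g /\ hlog (hexp g) = g.
Proof.
have [f f0 fE] := hlog_onto g.
by apply: (xgetPex 0 (ex_intro [set f : A | 0 < f /\ hlog f = g] f (conj f0 fE))).
Qed.

Lemma hlogK f : 0 < f -> hexp (hlog f) = f.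
Proof. by move=> f0; have [e0 eE] := hexpP (hlog f); exact: hlog_inj. Qed.

Lemma heps_mon m : heps (mon m) = 0.
Proof.
apply/hahn_eqP => n; rewrite hepsE (lead_monE (lead_mon_mon _ _ _)) /= eqxx invr1 mul1r.
have -> : (m * n == m)%g = (n == 1%g); last by rewrite subrr.
apply/eqP/eqP => [E|->]; last by rewrite mulg1.
by rewrite -[n]mul1g -(mulVg m) -mulgA E.
Qed.

Lemma hlog_mon m : hlog (mon m : A) = tlog m.
Proof.
rewrite hlogE heps_mon log1p0 (lead_monE (lead_mon_mon _ _ _)) /= eqxx.
by rewrite ln1 scale0r !addr0.
Qed.

Lemma hexp_tlog m : hexp (tlog m) = mon m :> A.
Proof. by rewrite -hlog_mon hlogK// mon_gt0. Qed.

Lemma gt_realsP f : gt_reals f <-> 0 < f /\ (1%g < lead_mon f)%O.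
Proof.
split=> [h|[f0 l1] r].
  have f0 : 0 < f by have := h 0; rewrite scale0r.
  split=> //; rewrite ltNge; apply/negP => l1.
  have lf := lead_monP (lt0r_neq0 f0).
  (* When no monomial of [f] exceeds 1, subtracting this real leaves the constant term -1, and the
     difference is negative. *)
  have := h (f 1%g + 1); rewrite -subr_gt0 (@lead_gt0 _ _ _ _ _ 1%g).
    by rewrite hahnDE hahnNE hahn_realE eqxx mulr1 opprD addrA subrr add0r oppr_gt0 ltr10.
  split; rewrite ?hahnDE ?hahnNE ?hahn_realE ?eqxx ?mulr1.
    by rewrite opprD addrA subrr add0r oppr_eq0 oner_eq0.
  move=> n n1; rewrite hahnDE hahnNE hahn_realE gt_eqF// mulr0 subr0 lf.2//.
  exact: le_lt_trans n1.
have lf := lead_monP (lt0r_neq0 f0).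
rewrite -subr_gt0 (@lead_gt0 _ _ _ _ _ (lead_mon f)).
  by rewrite hahnDE hahnNE hahn_realE gt_eqF// mulr0 subr0 gt0_lead_coef.
split=> [|n ln]; rewrite hahnDE hahnNE hahn_realE.
  by rewrite (gt_eqF l1) mulr0 subr0; case: lf.
by rewrite gt_eqF ?(lt_trans l1)// mulr0 subr0 lf.2.
Qed.

Definition lam m := lead_mon (tlog m).

Lemma lamP m : m != 1%g -> is_lead (tlog m) (lam m).
Proof. by move=> m1; apply: lead_monP; rewrite tlog_eq0. Qed.

Lemma lam_gt1 m : m != 1%g -> (1%g < lam m)%O.
Proof. by move=> /lamP[h _]; exact: tlog_supp_gt1 h. Qed.

(** The growth axiom is used with exponent 2: it gives [lam m * lam m <= m], and [lam m > 1] makes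
    the inequality strict. *)
Lemma lam_lt m : (1%g < m)%O -> (lam m < m)%O.
Proof.
move=> m1; have n1 : m != 1%g by rewrite gt_eqF.
have l1 := lam_gt1 n1; have l := lead_mul (lamP n1) (lamP n1).
have := tlog_growth m1 2; rewrite expr2 => h.
have l2 : (lam m * lam m <= m :> tmon A)%O%g.
  rewrite leNgt; apply/negP => ml.
  suff : mon m < tlog m * tlog m by rewrite ltNge ltW.
  rewrite -subr_gt0 (@lead_gt0 _ _ _ _ _ (lam m * lam m)%g).
    rewrite hahnDE hahnNE [mon m _]/= gt_eqF// subr0.
    by rewrite (lead_mulP (lamP n1) (lamP n1)).1 mulr_gt0 ?gt0_lead_coef ?tlog_gt0.
  split=> [|n ln]; rewrite hahnDE hahnNE [mon m _]/=.
    by rewrite (gt_eqF ml) subr0; case: l.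
  by rewrite gt_eqF ?(lt_trans ml)// subr0 l.2.
by apply: lt_le_trans l2; exact: omul_gt1l.
Qed.

Lemma hlog_gt_reals f : gt_reals f ->
  gt_reals (hlog f) /\ lead_mon (hlog f) = lam (lead_mon f).
Proof.
move=> /gt_realsP[f0 l1]; have n1 : lead_mon f != 1%g by rewrite gt_eqF.
have nf := lt0r_neq0 f0; have ll := lamP n1; have q1 := lam_gt1 n1.
have lh : is_lead (hlog f) (lam (lead_mon f)).
  split=> [|n ln]; first by rewrite hlog_gt1//; case: ll.
  by rewrite hlog_gt1 ?(lt_trans q1)//; exact: ll.2.
rewrite (lead_monE lh); split=> //; apply/gt_realsP.
rewrite (lead_monE lh) (lead_gt0 lh) hlog_gt1//; split=> //.
by rewrite gt0_lead_coef// tlog_gt0.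
Qed.

End LogExpLemmas.

(** * Monomials of the field of omega-series *)

Lemma decreasing_lt (d : Order.disp_t) (X : porderType d) (u : nat -> X) i j :
  (forall k, u k.+1 < u k)%O -> (i < j)%N -> (u j < u i)%O.
Proof.
move=> du; apply: (homo_ltn (r := fun x y => (y < x)%O)) => // y x z yx zy.
exact: lt_trans yx.
Qed.

Section Good.
Variables (K : regCardinal) (R : realType) (A : transseries K R) (T : tmon A).
Hypothesis hT : log_atomic T.
Implicit Types (f g : A) (m n p : tmon A).

Definition iter_log k : tmon A := lead_mon (iter k (@hlog _ _ A) (mon T)).
Local Notation t := iter_log.

Lemma iter_logE k : iter k (@hlog _ _ A) (mon T) = mon (t k).
Proof.
have [m mE] := hT.2 k.
by rewrite /iter_log mE (lead_monE (lead_mon_mon _ _ _)).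
Qed.

Lemma iter_log0 : t 0 = T.
Proof. exact: lead_monE (lead_mon_mon _ _ _). Qed.

Lemma tlog_iter_log k : tlog (t k) = mon (t k.+1).
Proof. by rewrite -hlog_mon -!iter_logE. Qed.

Lemma iter_log_gt1 k : (1%g < t k)%O.
Proof.
case: k => [|k]; first by rewrite iter_log0; exact: hT.1.
apply: (@tlog_supp_gt1 _ _ _ (t k)); rewrite tlog_iter_log.
by have [] := lead_mon_mon K R (t k.+1).
Qed.

Lemma lam_iter_log k : lam (t k) = t k.+1.
Proof. by rewrite /lam tlog_iter_log (lead_monE (lead_mon_mon _ _ _)). Qed.

Lemma iter_log_lt i j : (t i < t j)%O -> (j < i)%N.
Proof.
have tt k : (t k.+1 < t k)%O by rewrite -lam_iter_log lam_lt ?iter_log_gt1.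
case: (ltngtP j i) => [//|ij|->]; last by rewrite ltxx.
by rewrite ltNge (ltW (decreasing_lt tt ij)).
Qed.

(** A description of the monomials of the omega-series by logarithms alone, which provides induction
    on [tlog m]. The equivalence with [omega] is [good_omega_mon] and [omega_good]. *)
Inductive good : tmon A -> Prop :=
| good_iter_log k : good (t k)
| good_step m : (forall n, tlog m n != 0 -> good n) -> good m.

Lemma supp_mon m n : (mon m : A) n != 0 -> n = m.
Proof. by rewrite /=; have [//|_] := eqVneq n m; rewrite eqxx. Qed.

Lemma good_tlog m n : good m -> tlog m n != 0 -> good n.
Proof.
move=> gm; case: gm n => [k n|{}m]; last exact.
by rewrite tlog_iter_log => /supp_mon ->; exact: good_iter_log.
Qed.

Lemma good1 : good 1%g.
Proof. by apply: good_step => n; rewrite tlog1 eqxx. Qed.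

Lemma goodM m n : good m -> good n -> good (m * n)%g.
Proof.
move=> gm gn; apply: good_step => p; rewrite tlogM hahnDE.
have [->|mp _] := eqVneq (tlog m p) 0; last exact: good_tlog mp.
by rewrite add0r; exact: good_tlog.
Qed.

Lemma goodV m : good m -> good m^-1%g.
Proof.
move=> gm; apply: good_step => p; rewrite tlogV hahnNE oppr_eq0.
exact: good_tlog.
Qed.

Lemma good_lam m : good m -> m != 1%g -> good (lam m).
Proof. by move=> gm /lamP[h _]; exact: good_tlog h. Qed.

Lemma good_omega_mon m : good m -> omega T (mon m).
Proof.
elim=> {m} [k|m _ IH].
  rewrite -iter_logE; elim: k => [|k IH]; first exact: omega_var.
  by rewrite iterS; apply: omega_log => //; rewrite iter_logE mon_gt0.
by rewrite -hexp_tlog; apply/omega_exp/omega_sum.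
Qed.

Lemma good_omega f : (forall m, f m != 0 -> good m) -> omega T f.
Proof. by move=> h; apply: omega_sum => m /h; exact: good_omega_mon. Qed.

(** Series with good monomials are closed under the clauses of [omega]. For [hexp f], the logarithm
    of the leading monomial is a part of [f], and the infinitesimal part is controlled by
    [log1p_supp_inv]. *)
Lemma omega_good f m : omega T f -> f m != 0 -> good m.
Proof.
move=> hf; elim: hf m => {f} [r m||f _ IH m|f _ IH f0 p|f _ IH m fm].
- rewrite hahn_realE; have [-> _|_] := eqVneq m 1%g; first exact: good1.
  by rewrite mulr0 eqxx.
- by move=> m /supp_mon ->; rewrite -iter_log0; exact: good_iter_log.
- have [g0 gE] := hexpP f; move: (hexp f) g0 gE => g g0 gE.
  have ng := lt0r_neq0 g0.
  have gl : good (lead_mon g).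
    apply: good_step => n nn; apply: IH; rewrite -gE hlog_gt1//.
    exact: tlog_supp_gt1 nn.
  rewrite (heps_coef m ng) mulf_eq0 => /norP[_].
  have [-> //|_ +] := eqVneq m (lead_mon g); rewrite add0r => h.
  rewrite -[m](mulVKg (lead_mon g)); apply: goodM => //.
  apply: (log1p_supp_inv (heps_below ng) _ goodM h) => p pp; apply: IH.
  by rewrite -gE hlog_lt1//; exact: below_lt (log1p_below (heps_below ng)) pp.
- have nf := lt0r_neq0 f0; have gl : good (lead_mon f).
    by apply: IH; case: (lead_monP nf).
  case: (ltgtP p 1%g) => [p1|p1|-> _]; last exact: good1.
    rewrite hlog_lt1// => /(supp_log1p (heps_below nf) _ goodM); apply => n.
    move=> fn; have : heps f n != 0 := fn; rewrite hepsE.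
    have [-> _|_] := eqVneq n 1%g; first exact: good1.
    rewrite subr0 mulf_eq0 => /norP[_ /IH h].
    by rewrite -[n](mulKg (lead_mon f)); apply: goodM => //; exact: goodV.
  by rewrite hlog_gt1//; exact: good_tlog.
- have := IH m fm m; apply; by case: (lead_mon_mon K R m).
Qed.

Lemma good_pinf m : good m -> omega_pinf T (tlog m).
Proof.
move=> gm n nn; split; last exact: tlog_supp_gt1 nn.
exact: good_omega_mon (good_tlog gm nn).
Qed.

(* An induction on both components of a pair does not reach the pairs inside the
   support of a single logarithm, hence this hereditary predicate. The monomials
   [t k] occur in their own hereditary support and are treated apart. *)
Inductive pair_ok (C : tmon A -> tmon A -> Prop) : tmon A -> Prop :=
| pair_ok_iter_log k : pair_ok C (t k)
| pair_ok_step m : good m -> (forall a, tlog m a != 0 -> pair_ok C a) ->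
    (forall a b, tlog m a != 0 -> tlog m b != 0 -> C a b) -> pair_ok C m.

(** [C m n] and [C n m] are proved together, because mixed pairs from the two supports are required
    in both orders; pairs inside one support come from [pair_ok]. *)
Lemma good_pair_ind (C : tmon A -> tmon A -> Prop) :
  (forall i j, C (t i) (t j)) ->
  (forall m n, good m -> good n ->
    (forall a b, tlog m a != 0 \/ tlog n a != 0 ->
                 tlog m b != 0 \/ tlog n b != 0 -> C a b) -> C m n) ->
  forall m n, good m -> good n -> C m n.
Proof.
move=> Ct Cstep.
have step2 m n : good m -> good n ->
    (forall a b, tlog m a != 0 -> tlog m b != 0 -> C a b) ->
    (forall a b, tlog n a != 0 -> tlog n b != 0 -> C a b) ->
    (forall a b, tlog m a != 0 -> tlog n b != 0 -> C a b /\ C b a) ->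
    C m n /\ C n m.
  move=> gm gn mm nn mn; split; apply: Cstep => // a b [ma|na] [mb|nb].
  - exact: mm. - by case: (mn a b). - by case: (mn b a). - exact: nn.
  - exact: nn. - by case: (mn b a). - by case: (mn a b). - exact: mm.
have ttC k a b : tlog (t k) a != 0 -> tlog (t k) b != 0 -> C a b.
  by rewrite tlog_iter_log => /supp_mon -> /supp_mon ->.
have okC m n : pair_ok C m -> pair_ok C n -> C m n /\ C n m.
  move=> om; elim: om n => {m} [k n on|m gm om IHm Cm n on].
    elim: on k => {n} [l k|n gn _ IHn Cn k]; first by split.
    apply: step2 => //; [exact: good_iter_log|exact: ttC|] => a b.
    by rewrite tlog_iter_log => /supp_mon -> /IHn.
  case: on => [l|{}n gn on Cn]; apply: step2 => //; try exact: good_iter_log.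
  - exact: ttC.
  - move=> a b ma; rewrite tlog_iter_log => /supp_mon ->.
    by apply: IHm => //; exact: pair_ok_iter_log.
  - by move=> a b ma nb; apply: IHm => //; exact: on.
have gok m : good m -> pair_ok C m.
  elim=> {m} [k|m gm IH]; first exact: pair_ok_iter_log.
  apply: pair_ok_step => // [|a b /IH oa /IH ob]; first exact: good_step.
  by case: (okC a b).
by move=> m n /gok om /gok on; case: (okC m n).
Qed.

(** [lam m] lies in the support of [tlog m], so the induction applies to it, and it exceeds 1, so
    the iteration never stops at 1. *)
Lemma iter_lam m : good m -> m != 1%g ->
  exists k l, iter k (@lam _ _ A) m = t l.
Proof.
elim=> {m} [l _|m _ IH m1]; first by exists 0%N, l.
have [k [l E]] := IH _ (lamP m1).1 (negbT (gt_eqF (lam_gt1 m1))).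
by exists k.+1, l; rewrite iterSr.
Qed.

Lemma iter_lam_iter_log k l : iter k (@lam _ _ A) (t l) = t (k + l).
Proof. by elim: k => [|k IH] //; rewrite iterS IH lam_iter_log. Qed.

Lemma iter_lam_meet m n : good m -> m != 1%g -> good n -> n != 1%g ->
  exists k l, iter k (@lam _ _ A) m = iter l (@lam _ _ A) n.
Proof.
move=> gm m1 gn n1; have [k [i ki]] := iter_lam gm m1.
have [l [j lj]] := iter_lam gn n1; exists (j + k)%N, (i + l)%N.
by rewrite !iterD ki lj !iter_lam_iter_log addnC.
Qed.

End Good.

(** * Increments *)

Section Increment.
Variables (K : regCardinal) (R : realType) (A : transseries K R) (T : tmon A).
Hypothesis hT : log_atomic T.
Variables (d : Order.disp_t) (N : ogroupType d).
Local Notation H := (hahn K R N).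
Local Notation good := (good T).
Local Notation t := (iter_log T).
Local Notation lam := (@lam K R A).
Implicit Types (f g : A) (m n p q : tmon A).

(* Common abstraction of the derivation ([ev0 = id], [cut = false]) and of the
   difference [f |-> f o y - f o x] ([ev0 m] and [ev1 m] are the leading
   monomials of [m o x] and [m o y], and [cut = true]): the increment of
   [m = exp g] is [ev0 m] times that of [g], unless the latter is not
   infinitesimal in the case of differences. *)
Record increment (delta : A -> H) (ev0 ev1 : tmon A -> N) (cut : bool) : Prop :=
  Increment {
  inc_sum : forall f, (forall m, f m != 0 -> good m) ->
    is_sum (fun m => f m *: delta (mon m)) (delta f);
  inc_var : 0 < delta (mon T);
  inc_sg : forall m, good m -> Num.sg (delta (mon m)) = Num.sg (delta (tlog m));
  inc_ev0M : forall m n, good m -> good n -> ev0 (m * n)%g = (ev0 m * ev0 n)%g;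
  inc_ev0_lt : forall m n, good m -> good n -> (m < n)%O -> (ev0 m < ev0 n)%O;
  inc_ev1_lt : forall m n, good m -> good n -> (m < n)%O -> (ev1 m < ev1 n)%O;
  inc_small : forall m, good m -> delta (tlog m) != 0 ->
    (cut -> lead_mon (delta (tlog m)) < 1%g)%O ->
    lead_mon (delta (mon m)) = (ev0 m * lead_mon (delta (tlog m)))%g;
  inc_large : forall m, good m -> delta (tlog m) != 0 -> cut ->
    (1%g <= lead_mon (delta (tlog m)))%O ->
    lead_mon (delta (mon m)) = if 0 < delta (tlog m) then ev1 m else ev0 m;
  inc_le_ev1 : forall m, good m -> 0 < delta (tlog m) -> cut ->
    (lead_mon (delta (mon m)) <= ev1 m)%O }.

Variables (delta : A -> H) (ev0 ev1 : tmon A -> N) (cut : bool).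
Hypothesis inc : increment delta ev0 ev1 cut.
Local Notation dm m := (delta (mon m)).
Local Notation v m := (lead_mon (delta (mon m))).

Lemma inc_ev01 : ev0 1%g = 1%g.
Proof.
apply: (mulgI (ev0 1%g)); rewrite mulg1 -(inc_ev0M inc); try exact: good1.
by rewrite mulg1.
Qed.

Lemma inc_ev0_gt1 m : good m -> (1%g < m)%O -> (1%g < ev0 m)%O.
Proof. by move=> gm m1; rewrite -inc_ev01 (inc_ev0_lt inc)//; exact: good1. Qed.

Lemma inc_ev0_lt1 m : good m -> (m < 1%g)%O -> (ev0 m < 1%g)%O.
Proof. by move=> gm m1; rewrite -inc_ev01 (inc_ev0_lt inc)//; exact: good1. Qed.

Lemma inc_gt0 m : good m -> (0 < dm m) = (0 < delta (tlog m)).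
Proof. by move=> gm; rewrite -sgr_gt0 (inc_sg inc)// sgr_gt0. Qed.

Lemma inc_lt0 m : good m -> (dm m < 0) = (delta (tlog m) < 0).
Proof. by move=> gm; rewrite -sgr_lt0 (inc_sg inc)// sgr_lt0. Qed.

(** The monomial [n] only has to dominate after applying [delta]; it may lie below a constant term,
    whose increment vanishes. *)
Lemma inc_lead f n : (forall m, f m != 0 -> good m) -> f n != 0 -> dm n != 0 ->
  (forall m, f m != 0 -> m != n -> below (dm m) (v n)) ->
  is_lead (delta f) (v n) /\ delta f (v n) = f n * dm n (v n).
Proof.
move=> fg fn dn h; have [l1 l2] := lead_monP dn.
have E (x : N) : (v n <= x)%O -> delta f x = f n * dm n x.
  move=> nx; rewrite (is_sum_eq1 (i0 := n) (inc_sum inc fg))// => m mn.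
  rewrite hahnZE; have [->|fm] := eqVneq (f m) 0; first by rewrite mul0r.
  by rewrite h ?mulr0.
split; last exact: E.
split=> [|p np]; first by rewrite E// mulf_neq0.
by rewrite E ?ltW// l2 ?mulr0.
Qed.

Lemma inc_iter_log_gt0 k : 0 < dm (t k).
Proof.
elim: k => [|k IH]; first by rewrite iter_log0; exact: inc_var inc.
by move: IH; rewrite inc_gt0 ?tlog_iter_log//; exact: good_iter_log.
Qed.

(** Positivity and monotonicity go together: the sign of the increment of a logarithm is known once
    the increments of its monomials are compared. *)
Let incr m n := (1%g < m)%O -> (1%g < n)%O ->
  [/\ 0 < dm m, 0 < dm n & (m < n)%O -> (v m < v n)%O].

(** The term of [lam m] dominates the increment of [tlog m], and its coefficient is positive exactly
    when [m > 1]. *)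
Lemma inc_tlog m : good m -> m != 1%g ->
  (forall a b, tlog m a != 0 -> tlog m b != 0 -> incr a b) ->
  [/\ delta (tlog m) != 0, lead_mon (delta (tlog m)) = v (lam m) &
      (0 < delta (tlog m)) = (1%g < m)%O].
Proof.
move=> gm m1 h; have [lm hm] := lamP m1.
have q1 := lam_gt1 m1; have [dq _ _] := h _ _ lm lm q1 q1.
have [| | | |ld E] := @inc_lead (tlog m) (lam m) => //.
- by move=> a; exact: good_tlog.
- by rewrite gt_eqF.
- move=> a ma aq; have a1 := tlog_supp_gt1 ma.
  have [da _ aqv] := h _ _ ma lm a1 q1; apply: below_lead; first by rewrite gt_eqF.
  by apply: aqv; rewrite lt_neqAle aq (lead_ge (lamP m1)).
split; [exact: lead_neq0 ld|exact: lead_monE|].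
rewrite (lead_gt0 ld) E -tlog_gt0 (lead_gt0 (lamP m1)) pmulr_lgt0//.
exact: gt0_lead_coef.
Qed.

(** Either [v m] is [v (lam m)] multiplied by [ev0 m > 1], or it equals [ev1 m], which exceeds
    [ev1 (lam m)] and hence [v (lam m)]. *)
Lemma inc_lam_lt m : good m -> (1%g < m)%O -> 0 < delta (tlog m) ->
  lead_mon (delta (tlog m)) = v (lam m) ->
  (cut -> v (lam m) <= ev1 (lam m))%O -> (v (lam m) < v m)%O.
Proof.
move=> gm m1 d0 E h; have nd := lt0r_neq0 d0.
have nm1 : m != 1%g by rewrite gt_eqF.
have [/andP[c w1]|] := boolP (cut && (1%g <= v (lam m))%O); last first.
  rewrite negb_and => w; rewrite (inc_small inc gm nd) E.
    exact/omul_gt1l/inc_ev0_gt1.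
  by move=> c; move: w; rewrite c /= -ltNge.
rewrite (inc_large inc gm nd) ?E// d0; apply: le_lt_trans (h c) _.
by apply: (inc_ev1_lt inc) (lam_lt m1) => //; exact: good_lam.
Qed.

Lemma inc_incr m n : good m -> good n -> incr m n.
Proof.
apply: (good_pair_ind hT) => {m n} [i j _ _|m n gm gn h m1 n1].
  have dt k : (v (t k.+1) < v (t k))%O.
    have gk := good_iter_log T; have k1 := iter_log_gt1 hT.
    have E k' : delta (tlog (t k')) = dm (t k'.+1) by rewrite tlog_iter_log.
    rewrite -(lam_iter_log hT) inc_lam_lt ?E ?lam_iter_log ?inc_iter_log_gt0//.
    by move=> c; rewrite (inc_le_ev1 inc)// E inc_iter_log_gt0.
  split; rewrite ?inc_iter_log_gt0// => /(iter_log_lt hT).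
  exact: (decreasing_lt (u := fun k => v (t k))).
have nm1 : m != 1%g by rewrite gt_eqF.
have nn1 : n != 1%g by rewrite gt_eqF.
have [nm Em] := inc_tlog gm nm1 (fun a b ma mb => h a b (or_introl ma) (or_introl mb)).
rewrite m1 => dm0.
have [nn En] := inc_tlog gn nn1 (fun a b ma mb => h a b (or_intror ma) (or_intror mb)).
rewrite n1 => dn0.
split; rewrite ?inc_gt0// => mn.
(* Both logarithms are positive, so the larger one cannot have the smaller leading monomial. *)
have pq : (v (lam m) <= v (lam n))%O.
  have : (lam m <= lam n)%O.
    rewrite leNgt; apply/negP => nm'; have := tlog_lt mn.
    rewrite -subr_lt0 (@lead_lt0 _ _ _ _ _ (lam m)).
      rewrite hahnDE hahnNE (lamP nn1).2// subr0 ltNge ltW//.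
      by rewrite gt0_lead_coef// tlog_gt0.
    split=> [|q mq]; rewrite hahnDE hahnNE.
      by rewrite (lamP nn1).2// subr0; exact: (lamP nm1).1.
    by rewrite (lamP nn1).2 ?(lamP nm1).2 ?subr0//; exact: lt_trans mq.
  rewrite le_eqVlt => /orP[/eqP -> //|lmn].
  have [_ _ +] := h _ _ (or_introl (lamP nm1).1) (or_intror (lamP nn1).1)
     (lam_gt1 nm1) (lam_gt1 nn1).
  by move=> /(_ lmn)/ltW.
(* If the increment of [tlog n] is cut off, then [v m <= ev1 m < ev1 n = v n]; otherwise both [v m]
   and [v n] are given by [inc_small]. *)
have [/andP[c w1]|] := boolP (cut && (1%g <= v (lam n))%O).
  rewrite (inc_large inc gn nn) ?En// dn0.
  by apply: le_lt_trans (inc_le_ev1 inc gm dm0 c) _; exact: (inc_ev1_lt inc).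
rewrite negb_and => w.
have wn : (cut -> v (lam n) < 1%g)%O by move=> c; move: w; rewrite c /= -ltNge.
rewrite (inc_small inc gm nm) ?(inc_small inc gn nn) ?Em ?En//; last first.
  by move=> c; apply: le_lt_trans pq (wn c).
rewrite omulgC [(ev0 n * _)%g]omulgC; apply: olt_mul => //.
exact: (inc_ev0_lt inc).
Qed.

Lemma inc_lam m : good m -> m != 1%g ->
  [/\ delta (tlog m) != 0, lead_mon (delta (tlog m)) = v (lam m) &
      (0 < delta (tlog m)) = (1%g < m)%O].
Proof.
move=> gm m1; apply: inc_tlog => // a b ma mb.
by apply: inc_incr; [exact: good_tlog ma|exact: good_tlog mb].
Qed.

Lemma inc_mon_gt0 m : good m -> m != 1%g -> (0 < dm m) = (1%g < m)%O.
Proof. by move=> gm /(inc_lam gm)[_ _ <-]; exact: inc_gt0. Qed.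

Lemma inc_mon_neq0 m : good m -> m != 1%g -> dm m != 0.
Proof.
move=> gm /(inc_lam gm)[+ _ _]; rewrite neq_lt -inc_lt0// -inc_gt0//.
by rewrite -neq_lt.
Qed.

Lemma inc_mon1 : dm 1%g = 0.
Proof.
apply/eqP; rewrite -sgr_eq0 (inc_sg inc); last exact: good1.
rewrite tlog1 sgr_eq0; apply/eqP/hahn_eqP => p.
have g0 m : (0 : A) m != 0 -> good m by rewrite hahn0E eqxx.
by rewrite (is_sum_eq0 (inc_sum inc g0))// => m; rewrite scale0r.
Qed.

(** For differences, an increment [u < 0] of a logarithm yields a factor [e^u - 1] of the size of
    [u] if [u] is infinitesimal, and of size 1 otherwise; hence the minimum with 1, which makes
    [inc_lt1] uniform. *)
Definition mu m : N := if cut then Order.min 1%g (v m) else v m.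

(** One step along the iterates of [lam]: the upper bound is iterated in [lam_prodP], the lower
    bound in [inc_iter_lam]. *)
Lemma inc_le_mu p : good p -> (1%g < p)%O ->
  (mu p <= ev0 p * mu (lam p))%O%g /\ (mu (lam p) <= mu p)%O.
Proof.
move=> gp p1; have np1 : p != 1%g by rewrite gt_eqF.
have [nd E d0] := inc_lam gp np1; rewrite p1 in d0.
have e1 := inc_ev0_gt1 gp p1.
have mono : (v (lam p) < v p)%O.
  have gq := good_lam hT gp np1; have q1 := lam_gt1 np1.
  have nq1 : lam p != 1%g by rewrite gt_eqF.
  apply: inc_lam_lt => // c; apply: (inc_le_ev1 inc) => //.
  by have [_ _ ->] := inc_lam gq nq1.
have := @inc_small _ _ _ _ inc p gp nd; rewrite /mu E; case: (cut) => small; last first.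
  by rewrite small//; split=> //; rewrite -small// ltW.
split; last by rewrite le_min !ge_min lexx (ltW mono) orbT.
have [w1|w1] := ltP (v (lam p)) 1%g.
  by rewrite -small// ge_min lexx orbT.
by rewrite mulg1 ge_min (ltW e1).
Qed.

Lemma inc_le_v p : (mu p <= v p)%O.
Proof. by rewrite /mu; case: ifP => // _; rewrite ge_min lexx orbT. Qed.

Lemma inc_lt1 m : good m -> (m < 1%g)%O -> v m = (ev0 m * mu (lam m))%g.
Proof.
move=> gm m1; have nm1 : m != 1%g by rewrite lt_eqF.
have [nd E d0] := inc_lam gm nm1; rewrite /mu.
have small := inc_small inc gm nd; have large := inc_large inc gm nd.
have {}d0 : (0 < delta (tlog m)) = false by rewrite d0 ltNge ltW.
rewrite E in small; rewrite E d0 in large.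
have [c|c] := boolP cut; last by rewrite -small// (negbTE c).
have [w1|w1] := ltP 1%g (v (lam m)); first by rewrite mulg1 large// ltW.
move: w1; rewrite le_eqVlt => /orP[/eqP w1|w1]; last by rewrite small.
by rewrite w1 mulg1 large// w1.
Qed.

(** The product of the first [k] iterates, starting with [m] itself, collects the factors lost in
    [k] uses of [inc_le_mu]. *)
Fixpoint lam_prod k m : tmon A :=
  if k is k'.+1 then (m * lam_prod k' (lam m))%g else 1%g.

Lemma good_iter_lam k m : good m -> (1%g < m)%O ->
  good (iter k lam m) /\ (1%g < iter k lam m)%O.
Proof.
move=> gm m1; elim: k => [//|k [gk k1]]; have nk1 : iter k lam m != 1%g by rewrite gt_eqF.
by rewrite iterS; split; [exact: good_lam|exact: lam_gt1].
Qed.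

(** The logarithms of the iterates of [lam] at [q] have leading monomials at most [lam q < q]; so
    the product will be negligible against any [m] with [lam m = q]. *)
Lemma lam_prodP k q : good q -> (1%g < q)%O ->
  [/\ good (lam_prod k q), below (tlog (lam_prod k q)) q &
      (mu q <= ev0 (lam_prod k q) * mu (iter k lam q))%O%g].
Proof.
elim: k q => [|k IH] q gq q1 /=.
  by split; [exact: good1|rewrite tlog1|rewrite inc_ev01 mul1g].
have nq1 : q != 1%g by rewrite gt_eqF.
have [gp bp mp] := IH _ (good_lam hT gq nq1) (lam_gt1 nq1).
have lq := lam_lt q1; split; first exact: goodM.
  rewrite tlogM; apply: below_add; first by apply: below_lead; rewrite ?tlog_eq0.
  exact: below_trans (ltW lq) bp.
rewrite (inc_ev0M inc)// -mulgA -iterS iterSr.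
by apply: le_trans (inc_le_mu gq q1).1 _; exact: ole_mul2l.
Qed.

Lemma inc_iter_lam k p : good p -> (1%g < p)%O -> (mu (iter k lam p) <= mu p)%O.
Proof.
move=> gp p1; elim: k => [//|k IH]; have [gk k1] := good_iter_lam k gp p1.
by rewrite iterS; apply: le_trans IH; exact: (inc_le_mu gk k1).2.
Qed.

(** The iterates of [lam] from [lam m] and from [p] meet at a monomial with value [w] of [mu]. Then
    [mu p >= w] and [v m <= ev0 (m * P) * w], where [m * P < 1] because [tlog P] does not affect the
    leading term of [tlog m]. *)
Lemma inc_lt1_mu m p : good m -> (m < 1%g)%O -> good p -> (1%g < p)%O ->
  (v m < mu p)%O.
Proof.
move=> gm m1 gp p1; have nm1 : m != 1%g by rewrite lt_eqF.
have gq := good_lam hT gm nm1; have q1 := lam_gt1 nm1.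
have [k [l E]] := iter_lam_meet hT gq (negbT (gt_eqF q1)) gp (negbT (gt_eqF p1)).
apply: lt_le_trans (inc_iter_lam l gp p1); rewrite -E inc_lt1//.
have [gk bk mk] := lam_prodP k gq q1.
set P := lam_prod k _ in gk bk mk; set w := mu (iter k lam _) in mk *.
apply: (@le_lt_trans _ _ (ev0 m * (ev0 P * w))%g); first exact: ole_mul2l.
rewrite mulgA -(inc_ev0M inc)//; apply/omul_lt1l/inc_ev0_lt1; first exact: goodM.
have [lq hq] := lamP nm1; rewrite -tlog_lt0 tlogM (@lead_lt0 _ _ _ _ _ (lam m)).
  by rewrite hahnDE bk// addr0 -(lead_lt0 (lamP nm1)) tlog_lt0.
split=> [|n qn]; rewrite hahnDE bk ?addr0//; first exact: hq.
exact: ltW.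
Qed.

Lemma inc_mono m n : good m -> good n -> m != 1%g -> n != 1%g -> (m < n)%O ->
  (v m < v n)%O.
Proof.
move=> gm gn m1 n1 mn; have [ng|nl] := ltP 1%g n.
  have [mg|ml] := ltP 1%g m.
    by have [_ _] := inc_incr gm gn mg ng; exact.
  apply: lt_le_trans (inc_le_v n); apply: inc_lt1_mu => //.
  by rewrite lt_neqAle m1.
have {}nl : (n < 1%g)%O by rewrite lt_neqAle n1.
have ml := lt_trans mn nl; rewrite !inc_lt1//.
have gq := good_lam hT gm m1; have gp := good_lam hT gn n1.
have [qp|qp] := eqVneq (lam m) (lam n).
  by rewrite qp; apply: olt_mul2r; exact: (inc_ev0_lt inc).
have [lm hm] := lamP m1; have [ln hn] := lamP n1.
(* Both logarithms are negative, so the smaller one has the larger leading monomial. *)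
have pq : (lam n < lam m)%O.
  rewrite lt_neqAle eq_sym qp /= leNgt; apply/negP => qp'.
  have := tlog_lt mn; rewrite -subr_gt0 (@lead_gt0 _ _ _ _ _ (lam n)).
    rewrite hahnDE hahnNE hm// subr0 -(lead_gt0 (lamP n1)) tlog_gt0.
    by rewrite ltNge ltW.
  split=> [|a na]; rewrite hahnDE hahnNE; first by rewrite hm// subr0.
  by rewrite hn// hm ?subr0//; exact: lt_trans na.
(* Dividing by [ev0 n] reduces the claim to [v r < mu (lam n)], because [lam r = lam m]; this is
   [inc_lt1_mu]. *)
pose r := (n^-1 * m)%g; have gr : good r by apply: goodM => //; exact: goodV.
have r1 : (r < 1%g)%O by rewrite -(mulVg n); exact: olt_mul2l.
have lr : lam r = lam m.
  apply: lead_monE; rewrite tlogM tlogV; split=> [|a qa].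
    by rewrite hahnDE hahnNE hn// oppr0 add0r.
  by rewrite hahnDE hahnNE hn ?hm ?oppr0 ?add0r//; exact: lt_trans qa.
have mE : m = (n * r)%g by rewrite mulgA mulgV mul1g.
have := inc_lt1_mu gr r1 gp (lam_gt1 n1); rewrite inc_lt1// lr => h.
by rewrite [in ev0 m]mE (inc_ev0M inc)// -mulgA; exact: olt_mul2l.
Qed.

End Increment.

(** The leading coefficient of [f] without its constant term, with the sign reversed if the monomial
    is less than 1, since such monomials decrease. It is 0 for constant [f]. *)
Definition slope (K : regCardinal) (R : realType) (A : transseries K R) (f : A) : R :=
  let g := f - (f 1%g)%:A in
  g (lead_mon g) * (if (1%g < lead_mon g)%O then 1 else -1).

(** The right-hand sides do not mention [delta], which is how signs pass from the derivation to
    differences. By [inc_mono] the leading nonconstant term of [f] also dominates its increment. *)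
Lemma inc_slope (K : regCardinal) (R : realType) (A : transseries K R) (T : tmon A)
    (d : Order.disp_t) (N : ogroupType d) (delta : A -> hahn K R N)
    (ev0 ev1 : tmon A -> N) (cut : bool) (f : A) :
  log_atomic T -> increment T delta ev0 ev1 cut ->
  (forall m, f m != 0 -> good T m) ->
  (0 < delta f) = (0 < slope f) /\ (delta f < 0) = (slope f < 0).
Proof.
move=> hT inc fg; rewrite /slope; set g := f - _.
have gE m : m != 1%g -> g m = f m.
  by move=> m1; rewrite hahnDE hahnNE hahn_realE (negbTE m1) mulr0 subr0.
have g1 : g 1%g = 0 by rewrite hahnDE hahnNE hahn_realE eqxx mulr1 subrr.
have d1 := inc_mon1 inc.
have [g0|g0] := eqVneq g 0.
  suff -> : delta f = 0 by rewrite g0 !hahn0E mul0r !ltxx.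
  apply/hahn_eqP => x; rewrite hahn0E (is_sum_eq0 (inc_sum inc fg))// => m.
  have [->|m1] := eqVneq m 1%g; first by rewrite d1 scaler0.
  by rewrite -(gE _ m1) g0 hahn0E scale0r.
have lg := lead_monP g0; set n := lead_mon g in lg *.
have n1 : n != 1%g by apply: contraTneq lg.1 => ->; rewrite g1 eqxx.
have fn : f n != 0 by rewrite -gE//; case: lg.
have gn := fg n fn; have dn := inc_mon_neq0 hT inc gn n1.
have [|ld E] := inc_lead inc fg fn dn.
  move=> m fm mn; have [->|m1] := eqVneq m 1%g; first by rewrite d1.
  apply: below_lead; first by apply: (inc_mon_neq0 hT inc) => //; exact: fg.
  apply: (inc_mono hT inc) => //; first exact: fg.
  by rewrite lt_neqAle mn (lead_ge lg)// gE.
have pn := inc_mon_gt0 hT inc gn n1; have ldn := lead_monP dn.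
rewrite (lead_gt0 ld) (lead_lt0 ld) E gE//.
case: ifP pn => [_ pn|_ pn].
  have p0 : 0 < delta (mon n) (lead_mon (delta (mon n))) by rewrite -(lead_gt0 ldn) pn.
  by rewrite mulr1 pmulr_lgt0// pmulr_llt0.
have p0 : delta (mon n) (lead_mon (delta (mon n))) < 0.
  by rewrite -(lead_lt0 ldn) lt_neqAle dn leNgt pn.
by rewrite mulrN1 nmulr_lgt0// nmulr_llt0// oppr_gt0 oppr_lt0.
Qed.

(** * The derivation and the composition *)

(** Since [m = e^(log m)], [D m = m D(log m)], and the factor [m] is positive. *)
Lemma derivation_increment (K : regCardinal) (R : realType) (A : transseries K R)
    (T : tmon A) (D : A -> A) :
  log_atomic T -> is_derivation T D -> increment T D id id false.
Proof.
move=> hT hD; have DE m : good T m -> D (mon m) = mon m * D (tlog m).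
  by move=> gm; rewrite -(hexp_tlog m) (der_exp hD)//; exact: good_pinf.
split=> //.
- by move=> f fg; apply: (der_sum hD); exact: good_omega fg.
- by rewrite (der_var hD) ltr01.
- by move=> m gm; rewrite DE// sgrM gtr0_sg ?mul1r// mon_gt0.
- move=> m gm dm _; rewrite DE//; apply: lead_monE.
  exact: lead_mul (lead_mon_mon _ _ _) (lead_monP dm).
Qed.

Section Composition.
Variables (K : regCardinal) (R : realType) (A U : transseries K R) (T : tmon A).
Hypothesis hT : log_atomic T.
Variable comp : A -> U -> U.
Hypothesis hcomp : is_composition T comp.
Local Notation good := (good T).
Local Notation t := (iter_log T).

Section Evaluation.
Variable z : U.
Hypothesis hz : gt_reals z.
Implicit Types (f g : A) (m n p : tmon A).
Let c m := comp (mon m) z.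
Let ev m := lead_mon (c m).

(** Additivity is not among the axioms of [is_composition]; it follows from strong linearity and
    uniqueness of sums. *)
Lemma compB f g : (forall m, f m != 0 -> good m) -> (forall m, g m != 0 -> good m) ->
  comp (f - g) z = comp f z - comp g z.
Proof.
move=> fg gg; have fgg m : (f - g) m != 0 -> good m.
  rewrite hahnDE hahnNE; have [->|/fg//] := eqVneq (f m) 0.
  by rewrite add0r oppr_eq0; exact: gg.
have := is_sumB (comp_sum hcomp (good_omega hT fg) hz)
  (comp_sum hcomp (good_omega hT gg) hz).
apply: is_sum_uniq; have := comp_sum hcomp (good_omega hT fgg) hz.
by congr is_sum; apply/funext => m; rewrite hahnDE hahnNE scalerBl.
Qed.

Lemma comp0 : comp 0 z = 0.
Proof.
have g0 m : (0 : A) m != 0 -> good m by rewrite hahn0E eqxx.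
by have := compB g0 g0; rewrite !subrr.
Qed.

Lemma compD f g : (forall m, f m != 0 -> good m) -> (forall m, g m != 0 -> good m) ->
  comp (f + g) z = comp f z + comp g z.
Proof.
move=> fg gg; have g0 m : (0 : A) m != 0 -> good m by rewrite hahn0E eqxx.
have ng m : (0 - g) m != 0 -> good m by rewrite sub0r hahnNE oppr_eq0; exact: gg.
by rewrite -[X in f + X]opprK -[- g]sub0r compB// compB// comp0 sub0r opprK.
Qed.

Lemma comp_mon m : good m -> 0 < c m /\ hlog (c m) = comp (tlog m) z.
Proof.
move=> gm; rewrite /c -hexp_tlog (comp_exp hcomp)//; last exact: good_pinf.
by have [] := hexpP (comp (tlog m) z).
Qed.

Lemma comp_mon1 : ev 1%g = 1%g.
Proof.
have [c0 cE] := comp_mon (good1 T).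
have E : c 1%g = mon 1%g.
  by apply: hlog_inj; rewrite ?mon_gt0// cE hlog_mon !tlog1 comp0.
by rewrite /ev E (lead_monE (lead_mon_mon _ _ _)).
Qed.

Lemma comp_iter_log k : gt_reals (c (t k)) /\ ev (t k.+1) = lam (ev (t k)).
Proof.
have cS j : c (t j.+1) = hlog (c (t j)).
  by rewrite (comp_mon (good_iter_log T j)).2 tlog_iter_log.
have gk : gt_reals (c (t k)).
  elim: k => [|k IH]; first by rewrite iter_log0 /c (comp_var hcomp hz).
  by rewrite cS; have [] := hlog_gt_reals IH.
by split=> //; rewrite /ev cS; have [] := hlog_gt_reals gk.
Qed.

Lemma comp_lead g n : (forall m, g m != 0 -> good m) -> g n != 0 ->
  (forall m, g m != 0 -> m != n -> (ev m < ev n)%O) ->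
  is_lead (comp g z) (ev n) /\ comp g z (ev n) = g n * c n (ev n).
Proof.
move=> gg gn h; have cn m : g m != 0 -> c m != 0.
  by move=> /gg/comp_mon[c0 _]; rewrite gt_eqF.
have E (x : tmon U) : (ev n <= x)%O -> comp g z x = g n * c n x.
  move=> nx; have s := comp_sum hcomp (good_omega hT gg) hz.
  rewrite (is_sum_eq1 (i0 := n) s)// => m mn; rewrite hahnZE.
  have [->|gm] := eqVneq (g m) 0; first by rewrite mul0r.
  by rewrite (below_lead (cn _ gm) (h _ gm mn))// mulr0.
have [l1 l2] := lead_monP (cn _ gn); split; last exact: E.
split=> [|x nx]; first by rewrite E// mulf_neq0.
by rewrite E ?ltW// l2 ?mulr0.
Qed.

(** The first two clauses keep evaluated monomials above 1 infinite, so that a difference of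
    evaluated logarithms is infinite and separates leading monomials. *)
Let ev_incr m n :=
  [/\ (1%g < m)%O -> (1%g < ev m)%O, (1%g < n)%O -> (1%g < ev n)%O &
      (m < n)%O -> (ev m < ev n)%O].

(** The logarithms of the two values differ by [tlog n - tlog m] evaluated at [z], which is positive
    infinite; so the values have different leading monomials. *)
Lemma ev_step m n : good m -> good n ->
  (forall a b, tlog m a != 0 \/ tlog n a != 0 ->
               tlog m b != 0 \/ tlog n b != 0 -> ev_incr a b) ->
  (m < n)%O -> (ev m < ev n)%O.
Proof.
move=> gm gn h mn; pose g : A := tlog n - tlog m.
have gX a : g a != 0 -> tlog m a != 0 \/ tlog n a != 0.
  rewrite hahnDE hahnNE; have [->|] := eqVneq (tlog n a) 0; last by right.
  by rewrite add0r oppr_eq0; left.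
have g0 : 0 < g by rewrite subr_gt0 tlog_lt.
have lg := lead_monP (lt0r_neq0 g0); set p := lead_mon g in lg.
have p1 : (1%g < p)%O by case: (gX _ lg.1); exact: tlog_supp_gt1.
have hp : (1%g < ev p)%O by have [/(_ p1)] := h _ _ (gX _ lg.1) (gX _ lg.1).
have gg a : g a != 0 -> good a by move=> /gX[]; exact: good_tlog.
have [] := @comp_lead g p gg lg.1.
  move=> a ga ap; have [_ _] := h _ _ (gX _ ga) (gX _ lg.1); apply.
  by rewrite lt_neqAle ap (lead_ge lg).
have [cm mE] := comp_mon gm; have [cn nE] := comp_mon gn.
have -> : comp g z = hlog (c n) - hlog (c m).
  rewrite mE nE compB// => a; exact: good_tlog.
move=> lu E; have u0 : 0 < hlog (c n) - hlog (c m).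
  rewrite (lead_gt0 lu) E mulr_gt0//; first exact: gt0_lead_coef.
  by apply: gt0_lead_coef; have [] := comp_mon (gg _ lg.1).
have [_ _ _ _] : hlog_sub_spec (c m) (c n).
  by apply: hlog_subP => //; rewrite -hlog_lt// -subr_gt0.
by rewrite (lead_monE lu); apply.
Qed.

Lemma ev_lt m n : good m -> good n -> (m < n)%O -> (ev m < ev n)%O.
Proof.
move=> gm gn; suff [_ _] : ev_incr m n by [].
apply: (good_pair_ind hT _ _ gm gn) => {m n gm gn} [i j|m n gm gn h].
  have e1 k : (1%g < ev (t k))%O by have [/gt_realsP[]] := comp_iter_log k.
  have te k : (ev (t k.+1) < ev (t k))%O.
    by rewrite (comp_iter_log k).2 lam_lt.
  split=> // /(iter_log_lt hT).
  exact: (decreasing_lt (u := fun k => ev (t k))).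
split; last exact: ev_step.
(* The comparison is made with 1, whose logarithm has empty support and adds no pairs. *)
- move=> m1; rewrite -[X in (X < _)%O]comp_mon1; apply: ev_step => //; first exact: good1.
  by move=> a b; rewrite tlog1 eqxx => -[//|ma] [//|mb]; apply: h; left.
- move=> n1; rewrite -[X in (X < _)%O]comp_mon1; apply: ev_step => //; first exact: good1.
  by move=> a b; rewrite tlog1 eqxx => -[//|ma] [//|mb]; apply: h; right.
Qed.

(** [tlog (ev k)] is the purely infinite part of [tlog k] evaluated at [z], and both operations are
    additive. *)
Lemma evM m n : good m -> good n -> ev (m * n)%g = (ev m * ev n)%g.
Proof.
move=> gm gn; apply: tlog_inj; rewrite tlogM; apply/hahn_eqP => x.
have [x1|x1] := leP x 1%g; first by rewrite hahnDE !tlog_le1// addr0.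
have cE k : good k -> tlog (ev k) x = comp (tlog k) z x.
  move=> /comp_mon[c0 <-]; rewrite hlog_gt1//; exact: lt0r_neq0.
rewrite hahnDE !cE//; last exact: goodM.
by rewrite tlogM compD// => a; exact: good_tlog.
Qed.

End Evaluation.

Lemma lead_monN (f : U) : lead_mon (- f) = lead_mon f.
Proof.
have [->|f0] := eqVneq f 0; first by rewrite oppr0.
exact/lead_monE/lead_opp/lead_monP.
Qed.

Lemma composition_increment (x y : U) : gt_reals x -> gt_reals y -> x < y ->
  increment T (fun f => comp f y - comp f x)
    (fun m => lead_mon (comp (mon m) x)) (fun m => lead_mon (comp (mon m) y)) true.
Proof.
move=> hx hy xy; have cx m := @comp_mon x hx m; have cy m := @comp_mon y hy m.
split.
- move=> f fg; have := is_sumB (comp_sum hcomp (good_omega hT fg) hy)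
    (comp_sum hcomp (good_omega hT fg) hx).
  by congr is_sum; apply/funext => m; rewrite scalerBr.
- by rewrite !(comp_var hcomp)// subr_gt0.
- move=> m gm; have [x0 xE] := cx _ gm; have [y0 yE] := cy _ gm.
  rewrite -xE -yE; have [lt|lt|->] := ltgtP (comp (mon m) x) (comp (mon m) y).
  + by rewrite !gtr0_sg// subr_gt0// hlog_lt.
  + by rewrite !ltr0_sg// subr_lt0// hlog_lt.
  + by rewrite !subrr.
- by move=> m n; exact: evM.
- by move=> m n; exact: ev_lt.
- by move=> m n; exact: ev_lt.
- move=> m gm; have [x0 xE] := cx _ gm; have [y0 yE] := cy _ gm.
  rewrite -xE -yE => nu /(_ isT).
  have [lt|lt|E] := ltgtP (comp (mon m) x) (comp (mon m) y).
  + by have [_ _ _ h _] := hlog_subP x0 lt; move=> /h[].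
  (* Here the value decreases from [x] to [y]. As the increment of the logarithm is infinitesimal,
     both values share their leading monomial, and the factor is still that at [x]. *)
  + have [_ _ _ h _] := hlog_subP y0 lt; rewrite -lead_monN opprB => /h[<-].
    by rewrite -lead_monN opprB.
  + by move: nu; rewrite E subrr eqxx.
- move=> m gm; have [x0 xE] := cx _ gm; have [y0 yE] := cy _ gm.
  rewrite -xE -yE subr_gt0 hlog_lt// => nu _.
  have [lt|lt|E] := ltgtP (comp (mon m) x) (comp (mon m) y).
  + by have [_ _ h _ _] := hlog_subP x0 lt.
  + have [_ _ h _ _] := hlog_subP y0 lt; rewrite -lead_monN opprB => /h <-.
    by rewrite -lead_monN opprB.
  + by move: nu; rewrite E subrr eqxx.
- move=> m gm; have [x0 xE] := cx _ gm; have [y0 yE] := cy _ gm.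
  by rewrite -xE -yE subr_gt0 hlog_lt// => /(hlog_subP x0)[].
Qed.

End Composition.

Theorem theorem1 (K : regCardinal) (R : realType) (A U : transseries K R)
    (T : tmon A) (hT : log_atomic T)
    (D : A -> A) (hD : is_derivation T D)
    (comp : A -> U -> U) (hcomp : is_composition T comp)
    (f : A) (hf : omega T f) :
  [/\ 0 < D f -> forall x y : U, gt_reals x -> gt_reals y ->
        x < y -> comp f x < comp f y,
      D f < 0 -> forall x y : U, gt_reals x -> gt_reals y ->
        x < y -> comp f y < comp f x &
      D f = 0 -> forall x y : U, gt_reals x -> gt_reals y ->
        comp f x = comp f y].
Proof.
have fg m : f m != 0 -> good T m by exact: omega_good.
have [Dp Dn] := inc_slope hT (derivation_increment hT hD) fg.
(* The signs of [D f] and of the difference are both that of [slope f]. *)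
have sg x y : gt_reals x -> gt_reals y -> x < y ->
    (comp f x < comp f y) = (0 < D f) /\ (comp f y < comp f x) = (D f < 0).
  move=> hx hy xy.
  have := inc_slope hT (composition_increment hT hcomp hx hy xy) fg.
  by rewrite /= subr_gt0 subr_lt0 Dp Dn.
split=> [Df x y hx hy xy|Df x y hx hy xy|Df x y hx hy].
- by rewrite (sg _ _ hx hy xy).1.
- by rewrite (sg _ _ hx hy xy).2.
- have eq u v : gt_reals u -> gt_reals v -> u < v -> comp f u = comp f v.
    move=> hu hv /(sg _ _ hu hv); rewrite Df ltxx => -[lt gt].
    by apply/eqP; rewrite eq_le !leNgt lt gt.
  have [xy|yx|-> //] := ltgtP x y; first exact: eq.
  by apply/esym/eq.
Qed.
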